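(* Let $P$ be a finite poset and let $\mathcal{C}$ be a small abelian closed symmetric monoidal category with enough injectives. For a spread $Z \subset P$ and a $P$-module $N$, the Euler characteristic is given by \[ \chi(\mathbf{1}_Z, N) = \sum_{d \geq 0} (-1)^d \sum_{\substack{\sigma \in \Delta P \\ \dim \sigma = d \\ \min \sigma \in Z}} \left[ N(\max \sigma) \right] \] in $\mathcal{R}(\mathcal{C})$.
   Context: Let $(\mathcal{C},\otimes,\mathbf{1})$ be the monoidal category, with internal hom $\mathcal{H}om_{\mathcal{C}}(A,-)$ right adjoint to $-\otimes A$. A finite poset $P$ is viewed as a category with one morphism $a\to b$ whenever $a\le b$. A $P$-module is a functor $P\to\mathcal{C}$; $\mathcal{C}^P$ is the (abelian) category of $P$-modules and natural transformations; it has enough injectives when $\mathcal{C}$ does. Enriched hom: for $M,N\in\mathcal{C}^P$, $\underline{\mathrm{Hom}}(M,N) := \int_{a\in P}\mathcal{H}om_{\mathcal{C}}(M(a),N(a))$ (an end, an object of $\mathcal{C}$). The functor $\underline{\mathrm{Hom}}(M,-):\mathcal{C}^P\to\mathcal{C}$ is left exact, and $\underline{\mathrm{Ext}}^d(M,-)$ denotes its $d$-th right derived functor, computed by injective resolutions in $\mathcal{C}^P$. A spread is a subposet $Z\subset P$ such that for all $a\le c$ in $Z$ and all $b\in P$ with $a\le b\le c$, one has $b\in Z$. Its indicator module $\mathbf{1}_Z$ has $\mathbf{1}_Z(b)=\mathbf{1}$ (the monoidal unit) if $b\in Z$ and $0$ otherwise, with $\mathbf{1}_Z(a\le b)$ the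 identity if $a,b\in Z$ and zero otherwise. $\mathcal{R}(\mathcal{C})$ is the Grothendieck ring of $\mathcal{C}$, generated as an abelian group by isomorphism classes $[A]$ of objects subject to $[B]=[A]+[C]$ for each short exact sequence $0\to A\to B\to C\to0$; only this abelian group structure is used here. The Euler characteristic is $\chi(\mathbf{1}_Z,N):=\sum_{d\ge0}(-1)^d[\underline{\mathrm{Ext}}^d(\mathbf{1}_Z,N)]$ (the Ext objects vanish for large $d$). The order complex $\Delta P$ is the simplicial complex whose $d$-simplices are the chains $\sigma=(a_0<\cdots<a_d)$ in $P$; $\dim\sigma=d$, $\min\sigma=a_0$, $\max\sigma=a_d$. *)

(* Defs.v *)
From HB Require Import structures.
From mathcomp Require Import all_boot all_order all_algebra.
From mathcomp Require Import boolp classical_sets fsbigop.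
From mathcomp Require Import freeg.

Set Implicit Arguments.
Unset Strict Implicit.
Unset Printing Implicit Defensive.

Import Order.TTheory GRing.Theory.
Local Open Scope ring_scope.

Reserved Notation "g \c f" (at level 40, left associativity).

Record preaddCat := PreaddCat {
  ob :> Type;
  hom : ob -> ob -> zmodType;
  idm : forall A, hom A A;
  comp : forall A B D, hom B D -> hom A B -> hom A D;
  comp1m : forall A B (f : hom A B), comp (idm B) f = f;
  compm1 : forall A B (f : hom A B), comp f (idm A) = f;
  compA : forall A B D E (h : hom D E) (g : hom B D) (f : hom A B),
    comp h (comp g f) = comp (comp h g) f;
  compDl : forall A B D (g g' : hom B D) (f : hom A B),
    comp (g + g') f = comp g f + comp g' f;
  compDr : forall A B D (g : hom B D) (f f' : hom A B),
    comp g (f + f') = comp g f + comp g f'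
}.

Arguments hom {p} A B.
Arguments idm {p} A.
Arguments comp {p A B D} g f.
Notation "g \c f" := (comp g f) : ring_scope.

Section Notions.
Variable C : preaddCat.

Definition is_mono (A B : C) (f : hom A B) :=
  forall X (u v : hom X A), f \c u = f \c v -> u = v.

Definition is_epi (A B : C) (f : hom A B) :=
  forall X (u v : hom B X), u \c f = v \c f -> u = v.

Definition is_iso (A B : C) (f : hom A B) :=
  exists g : hom B A, g \c f = idm A /\ f \c g = idm B.

Definition is_zero (A : C) := idm A = 0.

Definition is_kernel (K A B : C) (k : hom K A) (f : hom A B) :=
  f \c k = 0 /\
  forall X (x : hom X A), f \c x = 0 -> exists! u : hom X K, k \c u = x.

Definition is_cokernel (A B Q : C) (q : hom B Q) (f : hom A B) :=
  q \c f = 0 /\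
  forall X (x : hom B X), x \c f = 0 -> exists! u : hom Q X, u \c q = x.

Definition is_biproduct (I : finType) (X : I -> C) (S : C)
    (p : forall i, hom S (X i)) (q : forall i, hom (X i) S) :=
  [/\ forall i, p i \c q i = idm (X i),
      forall i j, i != j -> p j \c q i = 0 &
      \sum_i (q i \c p i) = idm S].

(* The case of an empty I provides a zero object. *)
Record is_abelian : Prop := IsAbelian {
  ab_biproduct : forall (I : finType) (X : I -> C),
    exists S p q, @is_biproduct I X S p q;
  ab_kernel : forall (A B : C) (f : hom A B),
    exists K (k : hom K A), is_kernel k f;
  ab_cokernel : forall (A B : C) (f : hom A B),
    exists Q (q : hom B Q), is_cokernel q f;
  ab_mono : forall (A B : C) (f : hom A B), is_mono f ->
    exists D (g : hom B D), is_kernel f g;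
  ab_epi : forall (A B : C) (f : hom A B), is_epi f ->
    exists D (g : hom D A), is_cokernel f g
}.

Definition is_image (K A B : C) (k : hom K B) (f : hom A B) :=
  exists Q (q : hom B Q), is_cokernel q f /\ is_kernel k q.

Definition exact_at (A B D : C) (f : hom A B) (g : hom B D) :=
  exists K (k : hom K B), is_image k f /\ is_kernel k g.

Definition short_exact (A B D : C) (f : hom A B) (g : hom B D) :=
  [/\ is_mono f, exact_at f g & is_epi g].

Definition injective_ob (J : C) :=
  forall (A B : C) (m : hom A B) (f : hom A J), is_mono m ->
  exists g : hom B J, g \c m = f.

Definition enough_injectives :=
  forall A : C, exists (J : C) (m : hom A J), injective_ob J /\ is_mono m.

End Notions.

Record abelianCat := AbelianCat {
  acat :> preaddCat;
  acatP : is_abelian acat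
}.

Section PreaddTheory.
Variable C : preaddCat.
Implicit Types A B D : C.

Lemma comp0m A B D (f : hom A B) : (0 : hom B D) \c f = 0.
Proof. by apply: (addrI ((0 : hom B D) \c f)); rewrite -compDl !addr0. Qed.

Lemma compm0 A B D (g : hom B D) : g \c (0 : hom A B) = 0.
Proof. by apply: (addrI (g \c (0 : hom A B))); rewrite -compDr !addr0. Qed.

Lemma compNm A B D (g : hom B D) (f : hom A B) : (- g) \c f = - (g \c f).
Proof. by apply: (addrI (g \c f)); rewrite -compDl !subrr comp0m. Qed.

Lemma compmN A B D (g : hom B D) (f : hom A B) : g \c (- f) = - (g \c f).
Proof. by apply: (addrI (g \c f)); rewrite -compDr !subrr compm0. Qed.

Lemma compBl A B D (g g' : hom B D) (f : hom A B) :
  (g - g') \c f = g \c f - g' \c f.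
Proof. by rewrite compDl compNm. Qed.

Lemma compBr A B D (g : hom B D) (f f' : hom A B) :
  g \c (f - f') = g \c f - g \c f'.
Proof. by rewrite compDr compmN. Qed.

Lemma comp_suml A B D (I : finType) (g : I -> hom B D) (f : hom A B) :
  (\sum_i g i) \c f = \sum_i (g i \c f).
Proof.
by elim/big_rec2: _ => [|i x y _ <-]; [rewrite comp0m | rewrite compDl].
Qed.

Lemma comp_sumr A B D (I : finType) (g : hom B D) (f : I -> hom A B) :
  g \c (\sum_i f i) = \sum_i (g \c f i).
Proof.
by elim/big_rec2: _ => [|i x y _ <-]; [rewrite compm0 | rewrite compDr].
Qed.

Lemma kernel_mono K A B (k : hom K A) (f : hom A B) :
  is_kernel k f -> is_mono k.
Proof.
case=> fk0 ku X u v kuv.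
have [|w [_ wu]] := ku X (k \c u); first by rewrite compA fk0 comp0m.
by rewrite -(wu u) // -(wu v).
Qed.

Lemma cokernel_epi A B Q (q : hom B Q) (f : hom A B) :
  is_cokernel q f -> is_epi q.
Proof.
case=> qf0 qu X u v uqv.
have [|w [_ wu]] := qu X (u \c q); first by rewrite -compA qf0 compm0.
by rewrite -(wu u) // -(wu v).
Qed.

Lemma mono_eq0 A B (f : hom A B) X (u : hom X A) :
  is_mono f -> f \c u = 0 -> u = 0.
Proof. by move=> mf fu; apply: mf; rewrite fu compm0. Qed.

Lemma epi_eq0 A B (f : hom A B) X (u : hom B X) :
  is_epi f -> u \c f = 0 -> u = 0.
Proof. by move=> ef uf; apply: ef; rewrite uf comp0m. Qed.

Lemma mono_comp A B D (g : hom B D) (f : hom A B) :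
  is_mono g -> is_mono f -> is_mono (g \c f).
Proof. by move=> mg mf X u v; rewrite -!compA => /mg /mf. Qed.

Lemma mono_compl A B D (g : hom B D) (f : hom A B) :
  is_mono (g \c f) -> is_mono f.
Proof. by move=> mgf X u v fuv; apply: mgf; rewrite -!compA fuv. Qed.

Lemma kernel_cokernel K A B Q (k : hom K A) (g : hom A B) (q : hom A Q) :
  is_kernel k g -> is_cokernel q k -> is_kernel k q.
Proof.
move=> [gk0 ku] [qk0 qu]; split=> // X x qx0; apply: ku.
by have [w [<- _]] := qu _ g gk0; rewrite -compA qx0 compm0.
Qed.

Lemma cokernel_kernel K A B Q (q : hom A Q) (g : hom B A) (k : hom K A) :
  is_cokernel q g -> is_kernel k q -> is_cokernel q k.
Proof.
move=> [qg0 qu] [qk0 ku]; split=> // X x xk0; apply: qu.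
by have [w [<- _]] := ku _ g qg0; rewrite compA xk0 comp0m.
Qed.

End PreaddTheory.

Section Choices.
Variable C : abelianCat.

Section Kernel.
Variables (A B : C) (f : hom A B).

Definition ker_ob : C := projT1 (cid (ab_kernel (acatP C) f)).
Definition ker : hom ker_ob A :=
  projT1 (cid (projT2 (cid (ab_kernel (acatP C) f)))).
Lemma kerP : is_kernel ker f.
Proof. exact: projT2 (cid (projT2 (cid (ab_kernel (acatP C) f)))). Qed.

Definition coker_ob : C := projT1 (cid (ab_cokernel (acatP C) f)).
Definition coker : hom B coker_ob :=
  projT1 (cid (projT2 (cid (ab_cokernel (acatP C) f)))).
Lemma cokerP : is_cokernel coker f.
Proof. exact: projT2 (cid (projT2 (cid (ab_cokernel (acatP C) f)))). Qed.

Definition ker_lift X (x : hom X A) (fx0 : f \c x = 0) : hom X ker_ob :=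
  projT1 (cid (kerP.2 _ x fx0)).
Lemma ker_liftK X (x : hom X A) (fx0 : f \c x = 0) : ker \c ker_lift fx0 = x.
Proof. by rewrite /ker_lift; case: cid => u []. Qed.

Definition coker_desc X (x : hom B X) (xf0 : x \c f = 0) : hom coker_ob X :=
  projT1 (cid (cokerP.2 _ x xf0)).
Lemma coker_descK X (x : hom B X) (xf0 : x \c f = 0) :
  coker_desc xf0 \c coker = x.
Proof. by rewrite /coker_desc; case: cid => u []. Qed.

End Kernel.

Section Biproduct.
Variables (I : finType) (X : I -> C).

Definition bip_ob : C := projT1 (cid (ab_biproduct (acatP C) X)).
Let w := cid (projT2 (cid (ab_biproduct (acatP C) X))).
Definition bip_proj : forall i, hom bip_ob (X i) := projT1 w.
Definition bip_inj : forall i, hom (X i) bip_ob := projT1 (cid (projT2 w)).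
Lemma bipP : is_biproduct bip_proj bip_inj.
Proof. exact: projT2 (cid (projT2 w)). Qed.

Lemma bip_projK Y (e : forall i, hom Y (X i)) i :
  bip_proj i \c \sum_j (bip_inj j \c e j) = e i.
Proof.
have [pq pq0 _] := bipP.
rewrite comp_sumr (bigD1 i) //= big1 => [|j ji].
  by rewrite addr0 compA pq comp1m.
by rewrite compA pq0 // comp0m.
Qed.

Lemma bip_joint_mono Y (u v : hom Y bip_ob) :
  (forall i, bip_proj i \c u = bip_proj i \c v) -> u = v.
Proof.
have [_ _ s1] := bipP => uv.
rewrite -[u]comp1m -[v]comp1m -s1 !comp_suml.
by apply: eq_bigr => i _; rewrite -!compA uv.
Qed.

End Biproduct.

Definition zero_ob : C := bip_ob (fun v : void => match v with end).
Lemma zero_obP : is_zero zero_ob.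
Proof.
case: (bipP (fun v : void => match v return C with end)) => _ _.
by rewrite big1 // => -[].
Qed.

End Choices.

(* ker g / im f, as the cokernel of the map A -> ker g induced by f. *)
Definition cohomology (C : abelianCat) (A B D : C) (f : hom A B) (g : hom B D)
    (gf0 : g \c f = 0) : C := coker_ob (ker_lift gf0).

Record additive_functor (A B : preaddCat) := AdditiveFunctor {
  fob :> A -> B;
  fmap : forall X Y, hom X Y -> hom (fob X) (fob Y);
  fmap1 : forall X, fmap (idm X) = idm (fob X);
  fmapM : forall X Y Z (g : hom Y Z) (f : hom X Y),
    fmap (g \c f) = fmap g \c fmap f;
  fmapD : forall X Y (f g : hom X Y), fmap (f + g) = fmap f + fmap g
}.
Arguments fmap {A B} a {X Y} f.

Lemma fmap0 (A B : preaddCat) (F : additive_functor A B) X Y :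
  fmap F (0 : hom X Y) = 0.
Proof. by apply: (addrI (fmap F (0 : hom X Y))); rewrite -fmapD !addr0. Qed.

Record injective_resolution (A : preaddCat) (N : A) := InjectiveResolution {
  res_ob : nat -> A;
  res_aug : hom N (res_ob 0);
  res_d : forall n, hom (res_ob n) (res_ob n.+1);
  res_inj : forall n, injective_ob (res_ob n);
  res_mono : is_mono res_aug;
  res_exact0 : exact_at res_aug (res_d 0);
  res_exact : forall n, exact_at (res_d n) (res_d n.+1)
}.

Lemma exact_comp0 (A : preaddCat) (X Y Z : A) (f : hom X Y) (g : hom Y Z) :
  exact_at f g -> g \c f = 0.
Proof.
case=> K [k [[Q [q [[qf0 _] [_ ku]]]] [gk0 _]]].
by have [u [<- _]] := ku _ _ qf0; rewrite compA gk0 comp0m.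
Qed.

Section ResolutionExists.
Variables (A : abelianCat) (EI : enough_injectives A).

Definition inj_hull (X : A) : A := projT1 (cid (EI X)).
Definition inj_emb (X : A) : hom X (inj_hull X) :=
  projT1 (cid (projT2 (cid (EI X)))).
Lemma inj_hullP X : injective_ob (inj_hull X) /\ is_mono (inj_emb X).
Proof. exact: projT2 (cid (projT2 (cid (EI X)))). Qed.

Let arrow := {X : A & {Y : A & hom X Y}}.
Let src (s : arrow) : A := projT1 s.
Let tgt (s : arrow) : A := projT1 (projT2 s).
Let arr (s : arrow) : hom (src s) (tgt s) := projT2 (projT2 s).
Let mk (X Y : A) (f : hom X Y) : arrow :=
  existT (fun X => {Y : A & hom X Y}) X (existT (fun Y => hom X Y : Type) Y f).
Let next (s : arrow) : arrow :=
  mk (inj_emb (coker_ob (arr s)) \c coker (arr s)).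

Lemma chosen_resolution (N : A) : injective_resolution N.
Proof.
pose st := fix st n := if n is n'.+1 then next (st n')
                       else mk (inj_emb N).
have ex s : exact_at (arr s) (arr (next s)).
  have [qf0 _] := cokerP (arr s).
  exists (ker_ob (coker (arr s))), (ker (coker (arr s))); split.
    by exists (coker_ob (arr s)), (coker (arr s)); split; [exact: cokerP | exact: kerP].
  have [qk0 ku] := kerP (coker (arr s)); split.
    by rewrite -compA qk0 compm0.
  move=> X x; rewrite -compA => /(mono_eq0 (inj_hullP _).2); exact: ku.
apply: (@InjectiveResolution _ N (fun n => tgt (st n)) (arr (st 0%N))
          (fun n => arr (st n.+1))).
- by case=> [|n]; exact: (inj_hullP _).1.
- exact: (inj_hullP _).2.
- exact: ex.
- by move=> n; exact: ex.
Qed.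

End ResolutionExists.

Section Derived.
Variables (A : abelianCat) (EI : enough_injectives A) (B : abelianCat).
Variable F : additive_functor A B.

Lemma res_dd (N : A) (I : injective_resolution N) n :
  fmap F (res_d I n.+1) \c fmap F (res_d I n) = 0.
Proof. by rewrite -fmapM (exact_comp0 (res_exact I n)) fmap0. Qed.

(* The complex is F I^0 -> F I^1 -> ..., without F N; there is nothing to
   divide out in degree 0. *)
Definition res_cohomology (N : A) (I : injective_resolution N) (d : nat) : B :=
  match d with
  | 0 => ker_ob (fmap F (res_d I 0))
  | n.+1 => cohomology (res_dd I n)
  end.

(* Other resolutions give isomorphic objects. *)
Definition right_derived (d : nat) (N : A) : B :=
  res_cohomology (chosen_resolution EI N) d.

End Derived.

Section Modules.
Context {disp : Order.disp_t} (P : finPOrderType disp).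

Section Cat.
Variable C : preaddCat.

Record pmod := PMod {
  pm_ob :> P -> C;
  pm_map : forall a b : P, (a <= b)%O -> hom (pm_ob a) (pm_ob b);
  pm_id : forall a (aa : (a <= a)%O), pm_map aa = idm (pm_ob a);
  pm_comp : forall a b c (ab : (a <= b)%O) (bc : (b <= c)%O) (ac : (a <= c)%O),
    pm_map bc \c pm_map ab = pm_map ac
}.
Local Arguments pm_map p {a b} ab.

Section Hom.
Variables M N : pmod.

Record pmhom := PMHom {
  pm_fun :> forall a, hom (M a) (N a);
  pm_nat : forall a b (ab : (a <= b)%O),
    pm_map N ab \c pm_fun a = pm_fun b \c pm_map M ab
}.

Lemma pmhomP (f g : pmhom) : (forall a, f a = g a) -> f = g.
Proof.
case: f => f fn; case: g => g gn /= fg.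
have E := functional_extensionality_dep fg; case: _ / E gn {fg} => gn.
by rewrite (Prop_irrelevance fn gn).
Qed.

HB.instance Definition _ := gen_eqMixin pmhom.
HB.instance Definition _ := gen_choiceMixin pmhom.

Fact pmhom0_nat a b (ab : (a <= b)%O) :
  pm_map N ab \c (0 : hom (M a) (N a)) = 0 \c pm_map M ab.
Proof. by rewrite compm0 comp0m. Qed.
Definition pmhom0 := @PMHom (fun=> 0) pmhom0_nat.

Fact pmhomN_nat (f : pmhom) a b (ab : (a <= b)%O) :
  pm_map N ab \c (- f a) = (- f b) \c pm_map M ab.
Proof. by rewrite compmN compNm pm_nat. Qed.
Definition pmhomN (f : pmhom) := @PMHom (fun a => - f a) (pmhomN_nat f).

Fact pmhomD_nat (f g : pmhom) a b (ab : (a <= b)%O) :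
  pm_map N ab \c (f a + g a) = (f b + g b) \c pm_map M ab.
Proof. by rewrite compDr compDl !pm_nat. Qed.
Definition pmhomD (f g : pmhom) := @PMHom (fun a => f a + g a) (pmhomD_nat f g).

Fact pmhom_addA : associative pmhomD.
Proof. by move=> f g h; apply: pmhomP => a /=; rewrite addrA. Qed.
Fact pmhom_addC : commutative pmhomD.
Proof. by move=> f g; apply: pmhomP => a /=; rewrite addrC. Qed.
Fact pmhom_add0 : left_id pmhom0 pmhomD.
Proof. by move=> f; apply: pmhomP => a /=; rewrite add0r. Qed.
Fact pmhom_addN : left_inverse pmhom0 pmhomN pmhomD.
Proof. by move=> f; apply: pmhomP => a /=; rewrite addNr. Qed.

HB.instance Definition _ :=
  GRing.isZmodule.Build pmhom pmhom_addA pmhom_addC pmhom_add0 pmhom_addN.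

End Hom.

Fact pmhom_id_nat (M : pmod) a b (ab : (a <= b)%O) :
  pm_map M ab \c idm (M a) = idm (M b) \c pm_map M ab.
Proof. by rewrite compm1 comp1m. Qed.
Definition pmhom_id M : pmhom M M := PMHom (@pmhom_id_nat M).

Fact pmhom_comp_nat (M N L : pmod) (g : pmhom N L) (f : pmhom M N)
    a b (ab : (a <= b)%O) :
  pm_map L ab \c (g a \c f a) = (g b \c f b) \c pm_map M ab.
Proof. by rewrite compA pm_nat -compA pm_nat compA. Qed.
Definition pmhom_comp M N L (g : pmhom N L) (f : pmhom M N) : pmhom M L :=
  PMHom (pmhom_comp_nat g f).

Definition pmodPreadd : preaddCat.
Proof.
apply: (@PreaddCat pmod pmhom pmhom_id pmhom_comp).
- by move=> M N f; apply: pmhomP => a; exact: comp1m.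
- by move=> M N f; apply: pmhomP => a; exact: compm1.
- by move=> M N L K h g f; apply: pmhomP => a; exact: compA.
- by move=> M N L g g' f; apply: pmhomP => a; exact: compDl.
- by move=> M N L g f f'; apply: pmhomP => a; exact: compDr.
Defined.

Section Pointwise.
Variables (M N : pmodPreadd).

Lemma pm_sumE (I : finType) (f : I -> hom M N) a :
  (\sum_i f i : pmhom M N) a = \sum_i (f i : pmhom M N) a.
Proof. by elim/big_rec2: _ => // i x y _ <-. Qed.

Lemma pm_kernel (K : pmodPreadd) (k : hom K M) (f : hom M N) :
  (forall a, is_kernel ((k : pmhom K M) a) ((f : pmhom M N) a)) ->
  is_kernel k f.
Proof.
move=> H; split; first by apply: pmhomP => a; exact: (H a).1.
move=> X x fx0.
have fxa a : (f : pmhom M N) a \c (x : pmhom X M) a = 0.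
  by rewrite -[LHS]/((f \c x : pmhom X N) a) fx0.
pose u a := projT1 (cid ((H a).2 _ _ (fxa a))).
have uE a : (k : pmhom K M) a \c u a = (x : pmhom X M) a.
  by rewrite /u; case: cid => /= w [].
have unat a b (ab : (a <= b)%O) :
    pm_map (K : pmod) ab \c u a = u b \c pm_map (X : pmod) ab.
  apply: (kernel_mono (H b)).
  by rewrite compA -pm_nat -compA uE compA uE pm_nat.
exists (PMHom unat); split; first exact: pmhomP.
move=> v vE; apply: pmhomP => a /=; apply: (kernel_mono (H a)).
by rewrite uE -vE.
Qed.

Lemma pm_cokernel (Q : pmodPreadd) (q : hom N Q) (f : hom M N) :
  (forall a, is_cokernel ((q : pmhom N Q) a) ((f : pmhom M N) a)) ->
  is_cokernel q f.
Proof.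
move=> H; split; first by apply: pmhomP => a; exact: (H a).1.
move=> X x xf0.
have xfa a : (x : pmhom N X) a \c (f : pmhom M N) a = 0.
  by rewrite -[LHS]/((x \c f : pmhom M X) a) xf0.
pose u a := projT1 (cid ((H a).2 _ _ (xfa a))).
have uE a : u a \c (q : pmhom N Q) a = (x : pmhom N X) a.
  by rewrite /u; case: cid => /= w [].
have unat a b (ab : (a <= b)%O) :
    pm_map (X : pmod) ab \c u a = u b \c pm_map (Q : pmod) ab.
  apply: (cokernel_epi (H a)).
  by rewrite -!compA uE (pm_nat q) compA uE pm_nat.
exists (PMHom unat); split; first exact: pmhomP.
move=> v vE; apply: pmhomP => a /=; apply: (cokernel_epi (H a)).
by rewrite uE -vE.
Qed.

End Pointwise.
End Cat.

Section Abelian.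
Variable C : abelianCat.
Local Notation pmodPreadd := (pmodPreadd C).

Section KerCoker.
Variables (M N : pmodPreadd) (f : hom M N).
Let fa a : hom ((M : pmod C) a) ((N : pmod C) a) := (f : pmhom M N) a.

Lemma pm_kernel_ex : exists (K : pmodPreadd) (k : hom K M),
  forall a, is_kernel ((k : pmhom K M) a) (fa a).
Proof.
have h a b (ab : (a <= b)%O) :
    fa b \c (pm_map (M : pmod C) ab \c ker (fa a)) = 0.
  by rewrite compA -pm_nat -compA (kerP (fa a)).1 compm0.
pose km a b (ab : (a <= b)%O) := ker_lift (h a b ab).
have kmE a b (ab : (a <= b)%O) :
    ker (fa b) \c km a b ab = pm_map (M : pmod C) ab \c ker (fa a).
  exact: ker_liftK.
have k1 a (aa : (a <= a)%O) : km a a aa = idm (ker_ob (fa a)).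
  by apply: (kernel_mono (kerP (fa a))); rewrite kmE pm_id comp1m compm1.
have kc a b c (ab : (a <= b)%O) (bc : (b <= c)%O) (ac : (a <= c)%O) :
    km b c bc \c km a b ab = km a c ac.
  apply: (kernel_mono (kerP (fa c))).
  by rewrite compA !kmE -compA kmE compA (pm_comp _ ab bc ac).
exists (PMod k1 kc).
by exists (@PMHom C (PMod k1 kc) M (fun a => ker (fa a))
          (fun a b ab => esym (kmE a b ab))) => a; exact: kerP.
Qed.

Lemma pm_cokernel_ex : exists (Q : pmodPreadd) (q : hom N Q),
  forall a, is_cokernel ((q : pmhom N Q) a) (fa a).
Proof.
have h a b (ab : (a <= b)%O) :
    (coker (fa b) \c pm_map (N : pmod C) ab) \c fa a = 0.
  by rewrite -compA pm_nat compA (cokerP (fa b)).1 comp0m.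
pose km a b (ab : (a <= b)%O) := coker_desc (h a b ab).
have kmE a b (ab : (a <= b)%O) :
    km a b ab \c coker (fa a) = coker (fa b) \c pm_map (N : pmod C) ab.
  exact: coker_descK.
have k1 a (aa : (a <= a)%O) : km a a aa = idm (coker_ob (fa a)).
  by apply: (cokernel_epi (cokerP (fa a))); rewrite kmE pm_id comp1m compm1.
have kc a b c (ab : (a <= b)%O) (bc : (b <= c)%O) (ac : (a <= c)%O) :
    km b c bc \c km a b ab = km a c ac.
  apply: (cokernel_epi (cokerP (fa a))).
  by rewrite -compA !kmE compA kmE -compA (pm_comp _ ab bc ac).
exists (PMod k1 kc).
by exists (@PMHom C N (PMod k1 kc) (fun a => coker (fa a)) kmE) => a;
  exact: cokerP.
Qed.

Lemma pm_mono : is_mono f -> forall a, is_mono (fa a).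
Proof.
have [K [k kP]] := pm_kernel_ex.
move=> mf a X u v fuv; apply/eqP; rewrite -subr_eq0; apply/eqP.
have [w [<- _]] : exists! w, (k : pmhom K M) a \c w = u - v.
  by apply: (kP a).2; rewrite compBr fuv subrr.
have -> : k = 0 by apply: (mono_eq0 mf); exact: (pm_kernel kP).1.
exact: comp0m.
Qed.

Lemma pm_epi : is_epi f -> forall a, is_epi (fa a).
Proof.
have [Q [q qP]] := pm_cokernel_ex.
move=> ef a X u v fuv; apply/eqP; rewrite -subr_eq0; apply/eqP.
have [w [<- _]] : exists! w, w \c (q : pmhom N Q) a = u - v.
  by apply: (qP a).2; rewrite compBl fuv subrr.
have -> : q = 0 by apply: (epi_eq0 ef); exact: (pm_cokernel qP).1.
exact: compm0.
Qed.

End KerCoker.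

Lemma pm_pointwise_mono (M N : pmodPreadd) (f : hom M N) :
  (forall a, is_mono ((f : pmhom M N) a)) -> is_mono f.
Proof.
move=> mf X u v fuv; apply: pmhomP => a; apply: (mf a).
by rewrite -[LHS]/((f \c u : pmhom X N) a) fuv.
Qed.

Lemma pm_biproduct_ex (I : finType) (X : I -> pmodPreadd) :
  exists S p q, @is_biproduct pmodPreadd I X S p q.
Proof.
pose x a i : C := (X i : pmod C) a.
pose sm a b (ab : (a <= b)%O) : hom (bip_ob (x a)) (bip_ob (x b)) :=
  \sum_i (bip_inj (x b) i \c (pm_map (X i : pmod C) ab \c bip_proj (x a) i)).
have smp a b (ab : (a <= b)%O) i : bip_proj (x b) i \c sm a b ab =
    pm_map (X i : pmod C) ab \c bip_proj (x a) i.
  exact: bip_projK.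
have smq a b (ab : (a <= b)%O) i : sm a b ab \c bip_inj (x a) i =
    bip_inj (x b) i \c pm_map (X i : pmod C) ab.
  have [pq pq0 _] := bipP (x a).
  rewrite comp_suml (bigD1 i) //= big1 => [|j ji].
    by rewrite addr0 -!compA pq compm1.
  by rewrite -!compA pq0 1?eq_sym // !compm0.
have pj a X0 (u v : hom X0 (bip_ob (x a))) :
    (forall i, bip_proj (x a) i \c u = bip_proj (x a) i \c v) -> u = v.
  exact: bip_joint_mono.
have s1 a (aa : (a <= a)%O) : sm a a aa = idm (bip_ob (x a)).
  by apply: pj => i; rewrite smp pm_id comp1m compm1.
have sc a b c (ab : (a <= b)%O) (bc : (b <= c)%O) (ac : (a <= c)%O) :
    sm b c bc \c sm a b ab = sm a c ac.
  apply: pj => i.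
  by rewrite compA !smp -compA smp compA (pm_comp _ ab bc ac).
pose S : pmodPreadd := PMod s1 sc.
pose p i : hom S (X i) :=
  @PMHom C S (X i) (fun a => bip_proj (x a) i) (fun a b ab => esym (smp a b ab i)).
pose q i : hom (X i) S :=
  @PMHom C (X i) S (fun a => bip_inj (x a) i) (fun a b ab => smq a b ab i).
exists S, p, q; split.
- by move=> i; apply: pmhomP => a; have [+ _ _] := bipP (x a); exact.
- by move=> i j ij; apply: pmhomP => a; have [_ + _] := bipP (x a); exact.
- by apply: pmhomP => a; rewrite pm_sumE; have [_ _ +] := bipP (x a); exact.
Qed.

Lemma pmod_is_abelian : is_abelian pmodPreadd.
Proof.
split.
- exact: pm_biproduct_ex.
- move=> M N f; have [K [k kP]] := pm_kernel_ex f.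
  by exists K, k; exact: pm_kernel.
- move=> M N f; have [Q [q qP]] := pm_cokernel_ex f.
  by exists Q, q; exact: pm_cokernel.
- move=> M N f mf; have [Q [q qP]] := pm_cokernel_ex f.
  exists Q, q; apply: pm_kernel => a.
  have [D [g gP]] := ab_mono (acatP C) (pm_mono mf (a := a)).
  exact: kernel_cokernel gP (qP a).
- move=> M N f ef; have [K [k kP]] := pm_kernel_ex f.
  exists K, k; apply: pm_cokernel => a.
  have [D [g gP]] := ab_epi (acatP C) (pm_epi ef (a := a)).
  exact: cokernel_kernel gP (kP a).
Qed.

Definition pmodCat : abelianCat := AbelianCat pmod_is_abelian.

End Abelian.

Definition is_spread (Z : {set P}) : Prop :=
  forall a b c, a \in Z -> c \in Z -> (a <= b)%O -> (b <= c)%O -> b \in Z.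

Section Indicator.
Variable C : abelianCat.

Definition ind_ob (J : C) (x : bool) : C := if x then J else zero_ob C.
Definition ind_map (J : C) (x y : bool) : hom (ind_ob J x) (ind_ob J y) :=
  match x, y with true, true => idm J | _, _ => 0 end.

Lemma ind_map_id J x : ind_map J x x = idm (ind_ob J x).
Proof. by case: x => //=; rewrite zero_obP. Qed.

Lemma ind_map_comp J (x y z : bool) :
  (x -> z -> y) -> ind_map J y z \c ind_map J x y = ind_map J x z.
Proof.
case: x; case: y; case: z => //= H; rewrite ?comp1m ?compm0 ?comp0m //.
by have := H isT isT.
Qed.

Variables (J : C) (Z : {set P}) (spreadZ : is_spread Z).

Fact indicator_id a (aa : (a <= a)%O) :
  ind_map J (a \in Z) (a \in Z) = idm (ind_ob J (a \in Z)).
Proof. exact: ind_map_id. Qed.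

Fact indicator_comp a b c (ab : (a <= b)%O) (bc : (b <= c)%O) (ac : (a <= c)%O) :
  ind_map J (b \in Z) (c \in Z) \c ind_map J (a \in Z) (b \in Z) =
  ind_map J (a \in Z) (c \in Z).
Proof. by apply: ind_map_comp => aZ cZ; exact: spreadZ ab bc. Qed.

Definition indicator : pmod C :=
  @PMod C (fun a => ind_ob J (a \in Z))
    (fun a b _ => ind_map J (a \in Z) (b \in Z)) indicator_id indicator_comp.

End Indicator.

Section EnoughInjectives.
Variables (C : abelianCat) (EI : enough_injectives C).

Definition down (a : P) : {set P} := [set b | (b <= a)%O].
Lemma down_spread a : is_spread (down a).
Proof. by move=> x b c _; rewrite !inE => ca _ bc; exact: le_trans ca. Qed.
Arguments down_spread : clear implicits.

(* The maps M -> indicator J (down a) correspond to the maps M a -> J. *)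
Definition to_ind (J X : C) (x : bool) (h : x -> hom X J) : hom X (ind_ob J x) :=
  match x as x return (x -> hom X J) -> hom X (ind_ob J x) with
  | true => fun h => h isT | false => fun=> 0 end h.

Lemma down_le a b : b \in down a -> (b <= a)%O. Proof. by rewrite inE. Qed.

Definition to_down_fun (M : pmod C) a (J : C) (h : hom (M a) J) b :
    hom (M b) (ind_ob J (b \in down a)) :=
  to_ind (fun ba => h \c pm_map M (down_le ba)).

Lemma to_indT (J X : C) (x : bool) (h : x -> hom X J) (tx : x) :
  ind_map J x true \c to_ind h = h tx.
Proof.
by case: x h tx => //= h tx; rewrite comp1m (bool_irrelevance tx isT).
Qed.

Lemma to_down_nat (M : pmod C) a (J : C) (h : hom (M a) J) b c (bc : (b <= c)%O) :
  pm_map (indicator J (down_spread a)) bc \c to_down_fun h b =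
  to_down_fun h c \c pm_map M bc.
Proof.
rewrite /= /to_down_fun.
have cb : (c \in down a) -> (b \in down a).
  by rewrite !inE => /(le_trans bc).
move: (@down_le a b) (@down_le a c) cb.
case: (b \in down a); case: (c \in down a) => //= lb lc cb.
- by rewrite comp1m -compA (pm_comp _ bc (lc isT) (lb isT)).
- by rewrite !comp0m.
- by have := cb isT.
- by rewrite !comp0m.
Qed.

Definition to_down (M : pmod C) a (J : C) (h : hom (M a) J) :
  pmhom M (indicator J (down_spread a)) := PMHom (to_down_nat h).

Lemma to_downE (M : pmod C) a (J : C) (h : hom (M a) J) :
  ind_map J (a \in down a) true \c to_down h a = h.
Proof.
have aa : a \in down a by rewrite inE.
by rewrite /= /to_down_fun (to_indT _ aa) pm_id compm1.
Qed.

Lemma to_down_eq (M : pmod C) a (J : C)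
    (f g : pmhom M (indicator J (down_spread a))) :
  f a = g a -> f = g.
Proof.
move=> fg; apply: pmhomP => b.
have [bd|] := boolP (b \in down a); last first.
  move: (f b) (g b) => /=; case: (b \in down a) => //= u v _.
  by rewrite -[u]comp1m -[v]comp1m zero_obP !comp0m.
have ba := down_le bd; have aa : a \in down a by rewrite inE.
have E := pm_nat f ba; rewrite fg -(pm_nat g ba) in E; move: E => /=.
move: (f b) (g b) => /=; rewrite bd aa /= => u v.
by rewrite !comp1m.
Qed.

Lemma down_injective a (J : C) :
  injective_ob J -> @injective_ob (pmodCat C) (indicator J (down_spread a)).
Proof.
move=> IJ M N m f mm.
have [g gm] := IJ _ _ _ (ind_map J (a \in down a) true \c (f : pmhom _ _) a)
  (pm_mono mm (a := a)).
exists (to_down g); apply: to_down_eq.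
have mono1 : is_mono (ind_map J (a \in down a) true).
  have -> : (a \in down a) = true by rewrite inE lexx.
  by move=> X u v /=; rewrite !comp1m.
by apply: mono1; rewrite [LHS]compA to_downE.
Qed.

Lemma biproduct_injective (A : abelianCat) (I : finType) (X : I -> A) :
  (forall i, injective_ob (X i)) -> injective_ob (bip_ob X).
Proof.
move=> IX M N m f mm; have [pq pq0 s1] := bipP X.
have h i := cid (IX i _ _ m (bip_proj X i \c f) mm).
exists (\sum_i (bip_inj X i \c projT1 (h i))).
rewrite comp_suml -[RHS]comp1m -s1 comp_suml; apply: eq_bigr => i _.
by rewrite -!compA; case: (h i) => /= g ->.
Qed.

Lemma pmod_enough_injectives : enough_injectives (pmodCat C).
Proof.
move=> M; pose J a := inj_hull EI ((M : pmod C) a).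
pose R a : pmodCat C := indicator (J a) (down_spread a).
pose e a : hom M (R a) := to_down (inj_emb EI ((M : pmod C) a)).
exists (bip_ob R), (\sum_a (bip_inj R a \c e a)); split.
  apply: biproduct_injective => a; apply: down_injective.
  exact: (inj_hullP EI _).1.
set m := \sum_a _; apply: pm_pointwise_mono => a.
have pm : bip_proj R a \c m = e a by exact: bip_projK.
apply: (@mono_compl _ _ _ _ ((bip_proj R a : pmhom _ _) a)).
rewrite -[X in is_mono X]/((bip_proj R a \c m : pmhom _ _) a) pm.
apply: (@mono_compl _ _ _ _ (ind_map (J a) (a \in down a) true)).
by rewrite to_downE; exact: (inj_hullP EI _).2.
Qed.

End EnoughInjectives.
End Modules.

Arguments pm_map {disp P C} p {a b} ab.

Reserved Notation "A \ot B" (at level 40, left associativity).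
Reserved Notation "f \otm g" (at level 40, left associativity).

Record monoidal (C : preaddCat) := Monoidal {
  tens : C -> C -> C;
  tensm : forall A A' B B' : C,
    hom A A' -> hom B B' -> hom (tens A B) (tens A' B');
  munit : C;
  massoc : forall A B D : C, hom (tens (tens A B) D) (tens A (tens B D));
  mlunit : forall A : C, hom (tens munit A) A;
  mrunit : forall A : C, hom (tens A munit) A;
  tensm1 : forall A B : C, tensm (idm A) (idm B) = idm (tens A B);
  tensmM : forall (A A' A'' B B' B'' : C) (f' : hom A' A'') (f : hom A A')
    (g' : hom B' B'') (g : hom B B'),
    tensm (f' \c f) (g' \c g) = tensm f' g' \c tensm f g;
  massoc_iso : forall A B D : C, is_iso (massoc A B D);
  mlunit_iso : forall A : C, is_iso (mlunit A);
  mrunit_iso : forall A : C, is_iso (mrunit A);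
  massoc_nat : forall (A A' B B' D D' : C)
    (f : hom A A') (g : hom B B') (h : hom D D'),
    massoc A' B' D' \c tensm (tensm f g) h =
    tensm f (tensm g h) \c massoc A B D;
  mlunit_nat : forall (A A' : C) (f : hom A A'),
    mlunit A' \c tensm (idm munit) f = f \c mlunit A;
  mrunit_nat : forall (A A' : C) (f : hom A A'),
    mrunit A' \c tensm f (idm munit) = f \c mrunit A;
  pentagon : forall A B D E : C,
    massoc A B (tens D E) \c massoc (tens A B) D E =
    tensm (idm A) (massoc B D E) \c massoc A (tens B D) E
      \c tensm (massoc A B D) (idm E);
  triangle : forall A B : C,
    tensm (idm A) (mlunit B) \c massoc A munit B = tensm (mrunit A) (idm B)
}.
Arguments munit {C} m.
Arguments massoc {C m} A B D.
Arguments mlunit {C m} A.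
Arguments mrunit {C m} A.
Notation "A \ot B" := (tens _ A B) : ring_scope.
Notation "f \otm g" := (tensm _ f g) : ring_scope.

Record symMonoidal (C : preaddCat) := SymMonoidal {
  sm_monoidal :> monoidal C;
  braid : forall A B : C, hom (tens sm_monoidal A B) (tens sm_monoidal B A);
  braid_nat : forall (A A' B B' : C) (f : hom A A') (g : hom B B'),
    braid A' B' \c (f \otm g) = (g \otm f) \c braid A B;
  braidK : forall A B : C, braid B A \c braid A B = idm (A \ot B);
  hexagon : forall A B D : C,
    massoc B D A \c braid A (B \ot D) \c massoc A B D =
    (idm B \otm braid A D) \c massoc B A D \c (braid A B \otm idm D)
}.

(* [ihom A] is right adjoint to [_ \ot A], with counit [ihom_ev A]. *)
Record closedSymMonoidal (C : preaddCat) := ClosedSymMonoidal {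
  csm_sym :> symMonoidal C;
  ihom : C -> C -> C;
  ihom_ev : forall A B : C, hom (tens csm_sym (ihom A B) A) B;
  ihom_curry : forall X A B : C, hom (tens csm_sym X A) B -> hom X (ihom A B);
  ihom_curryK : forall (X A B : C) (f : hom (tens csm_sym X A) B),
    ihom_ev A B \c (ihom_curry f \otm idm A) = f;
  ihom_evK : forall (X A B : C) (g : hom X (ihom A B)),
    ihom_curry (ihom_ev A B \c (g \otm idm A)) = g
}.
Arguments ihom_ev {C} V A B : rename.
Arguments ihom_curry {C} V {X A B} f : rename.

Section InternalHom.
Variables (C : preaddCat) (V : closedSymMonoidal C).
Local Notation ihom := (ihom V).

Definition ihom_map (A A' B B' : C) (f : hom A' A) (g : hom B B') :
    hom (ihom A B) (ihom A' B') :=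
  ihom_curry V (g \c ihom_ev V A B \c (idm (ihom A B) \otm f)).

Lemma ihom_joint X (A B : C) (u v : hom X (ihom A B)) :
  ihom_ev V A B \c (u \otm idm A) = ihom_ev V A B \c (v \otm idm A) -> u = v.
Proof. by move=> uv; rewrite -[u]ihom_evK uv ihom_evK. Qed.

Lemma ihom_ev_map (A A' B B' : C) (f : hom A' A) (g : hom B B') X
    (u : hom X (ihom A B)) :
  ihom_ev V A' B' \c ((ihom_map f g \c u) \otm idm A') =
  g \c ihom_ev V A B \c (u \otm f).
Proof.
rewrite -[X in _ \otm X]comp1m tensmM compA ihom_curryK.
by rewrite -!compA -tensmM comp1m compm1.
Qed.

Lemma ihom_map1 (A B : C) : ihom_map (idm A) (idm B) = idm (ihom A B).
Proof.
by rewrite /ihom_map tensm1 compm1 -[RHS]ihom_evK tensm1 comp1m compm1.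
Qed.

Lemma ihom_mapM (A A' A'' B B' B'' : C) (f' : hom A'' A') (f : hom A' A)
    (g' : hom B' B'') (g : hom B B') :
  ihom_map (f \c f') (g' \c g) = ihom_map f' g' \c ihom_map f g.
Proof.
apply: ihom_joint; rewrite ihom_ev_map -[ihom_map _ _]compm1 ihom_ev_map.
have -> : tensm V (ihom_map f g) f' =
    tensm V (ihom_map f g) (idm A') \c tensm V (idm _) f'.
  by rewrite -tensmM comp1m compm1.
rewrite -!compA [ihom_ev V A' B' \c _]compA -[ihom_map f g]compm1 ihom_ev_map.
by rewrite -!compA -tensmM comp1m.
Qed.

End InternalHom.

Section InternalHomAdditive.
Variables (C : abelianCat) (V : closedSymMonoidal C).
Local Notation ihom := (ihom V).

Lemma tens_zero (A B : C) (u v : hom (tens V (zero_ob C) A) B) : u = v.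
Proof.
rewrite -[u]ihom_curryK -[v]ihom_curryK.
rewrite -[ihom_curry V u]compm1 -[ihom_curry V v]compm1 zero_obP.
by rewrite !compm0.
Qed.

Lemma tens0m (A B X Y : C) (f : hom A B) : tensm V (0 : hom X Y) f = 0.
Proof.
rewrite -[f]compm1 -(@compm0 C X (zero_ob C) Y 0) tensmM.
by rewrite (tens_zero (0 \otm f) 0) comp0m.
Qed.

Lemma ihom_map0 (A A' B B' : C) (f : hom A' A) :
  ihom_map V f (0 : hom B B') = 0.
Proof.
apply: ihom_joint; rewrite -[ihom_map _ _ _]compm1 ihom_ev_map.
by rewrite !comp0m tens0m compm0.
Qed.

Lemma ihom_mapD (A B B' : C) (g g' : hom B B') :
  ihom_map V (idm A) (g + g') = ihom_map V (idm A) g + ihom_map V (idm A) g'.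
Proof.
pose X (b : bool) := B'.
have [pq pq0 s1] := bipP X.
pose G (B1 B2 : C) (h : hom B1 B2) := ihom_map V (idm A) h.
have GM B1 B2 B3 (h : hom B2 B3) (k : hom B1 B2) : G _ _ (h \c k) = G _ _ h \c G _ _ k.
  by rewrite /G -ihom_mapM comp1m.
have joint Y (u v : hom Y (ihom A (bip_ob X))) :
    (forall b, G _ _ (bip_proj X b) \c u = G _ _ (bip_proj X b) \c v) -> u = v.
  move=> uv; apply: ihom_joint; apply: bip_joint_mono => b.
  have := congr1 (fun w => ihom_ev V A B' \c (w \otm idm A)) (uv b).
  by rewrite /= !ihom_ev_map -!compA.
have S : \sum_b (G _ _ (bip_inj X b) \c G _ _ (bip_proj X b)) = idm _.
  apply: joint => b; rewrite comp_sumr (bigD1 b) //= big1 => [|c cb].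
    by rewrite addr0 compA -GM pq /G ihom_map1 comp1m compm1.
  by rewrite compA -GM pq0 // /G ihom_map0 comp0m.
pose h := \sum_b (bip_inj X b \c (if b then g else g')).
pose D : hom (bip_ob X) B' := \sum_(b : bool) (bip_proj X b : hom (bip_ob X) B').
have ph b : bip_proj X b \c h = if b then g else g' by rewrite bip_projK.
have gD : g + g' = D \c h.
  by rewrite /D comp_suml big_bool !ph.
have GD : G _ _ D = \sum_(b : bool) (G _ B' (bip_proj X b)).
  rewrite -[G _ _ D]compm1 -S comp_sumr; apply: eq_bigr => b _.
  rewrite compA -GM /D comp_suml (bigD1 b) //= big1 => [|c cb].
    by rewrite addr0 pq /G ihom_map1 comp1m.
  by rewrite pq0 // eq_sym.
by rewrite gD -/(G _ _ _) GM GD comp_suml big_bool /= -!GM !ph.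
Qed.

End InternalHomAdditive.

Section EnrichedHom.
Context {disp : Order.disp_t} (P : finPOrderType disp).
Variables (C : abelianCat) (V : closedSymMonoidal C).
Local Notation ihom := (ihom V).
Local Notation ihom_map := (ihom_map V).
Local Notation pmod := (pmod P C).

Definition is_wedge (M N : pmod) (X : C)
    (x : forall a : P, hom X (ihom (M a) (N a))) :=
  forall a b (ab : (a <= b)%O),
    ihom_map (idm (M a)) (pm_map N ab) \c x a =
    ihom_map (pm_map M ab) (idm (N b)) \c x b.

Definition is_end (M N : pmod) (E : C)
    (pi : forall a : P, hom E (ihom (M a) (N a))) :=
  is_wedge pi /\
  forall X (x : forall a : P, hom X (ihom (M a) (N a))), is_wedge x ->
  exists! u : hom X E, forall a, pi a \c u = x a.

Lemma end_ex (M N : pmod) : exists E pi, @is_end M N E pi.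
Proof.
pose X a := ihom (M a) (N a).
pose Y (e : P * P) := ihom (M e.1) (N e.2).
pose w (e : P * P) : hom (bip_ob X) (Y e) :=
  match pselect (e.1 <= e.2)%O with
  | left ab => ihom_map (idm (M e.1)) (pm_map N ab) \c bip_proj X e.1
                  - ihom_map (pm_map M ab) (idm (N e.2)) \c bip_proj X e.2
  | right _ => 0
  end.
pose W := \sum_e (bip_inj Y e \c w e).
have wE Z (z : hom Z (bip_ob X)) :
    W \c z = 0 <-> is_wedge (fun a => bip_proj X a \c z).
  split=> [Wz a b ab|wz].
    have : w (a, b) \c z = 0.
      by rewrite -(bip_projK w (a, b)) -compA Wz compm0.
    rewrite /w /=; case: pselect => // ab'.
    rewrite (bool_irrelevance ab' ab) compBl -!compA => /eqP.
    by rewrite subr_eq0 => /eqP.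
  apply: bip_joint_mono => -[a b]; rewrite compA bip_projK compm0 /w /=.
  case: pselect => [ab|_]; last by rewrite comp0m.
  by rewrite compBl -!compA wz subrr.
exists (ker_ob W), (fun a => bip_proj X a \c ker W); split.
  by apply/wE; exact: (kerP W).1.
move=> Z z zw; pose zz := \sum_a (bip_inj X a \c z a).
have zzE a : bip_proj X a \c zz = z a by exact: bip_projK.
have [|u [uz uu]] := (kerP W).2 _ zz.
  by apply/wE => a b ab; rewrite !zzE.
exists u; split=> [a|v vz]; first by rewrite -compA uz zzE.
by apply: uu; apply: bip_joint_mono => a; rewrite zzE compA (vz a).
Qed.

Definition end_ob (M N : pmod) : C := projT1 (cid (end_ex M N)).
Definition end_proj (M N : pmod) :
    forall a : P, hom (end_ob M N) (ihom (M a) (N a)) :=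
  projT1 (cid (projT2 (cid (end_ex M N)))).
Lemma endP (M N : pmod) : is_end (end_proj M N).
Proof. exact: projT2 (cid (projT2 (cid (end_ex M N)))). Qed.
Arguments end_proj : clear implicits.

Definition end_lift (M N : pmod) (X : C)
    (x : forall a : P, hom X (ihom (M a) (N a))) (xw : is_wedge x) :
  hom X (end_ob M N) := projT1 (cid ((endP M N).2 X x xw)).
Lemma end_liftK (M N : pmod) (X : C)
    (x : forall a : P, hom X (ihom (M a) (N a))) (xw : is_wedge x) a :
  end_proj M N a \c end_lift xw = x a.
Proof. by rewrite /end_lift; case: cid => u []. Qed.

Lemma end_joint (M N : pmod) (X : C) (u v : hom X (end_ob M N)) :
  (forall a, end_proj M N a \c u = end_proj M N a \c v) -> u = v.
Proof.
move=> uv; have [|w [_ wu]] :=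
  (endP M N).2 X (fun a => end_proj M N a \c v).
  by move=> a b ab; rewrite !compA (endP M N).1.
by rewrite -(wu u) // -(wu v).
Qed.

Section Functor.
Variable M : pmod.

Fact ehom_wedge (N N' : pmod) (t : pmhom N N') :
  is_wedge (fun a => ihom_map (idm (M a)) (t a) \c end_proj M N a).
Proof.
move=> a b ab; rewrite !compA -!ihom_mapM !comp1m pm_nat -{1}[idm (M a)]comp1m ihom_mapM.
rewrite -compA (endP M N).1 compA.
by rewrite -ihom_mapM !compm1.
Qed.

Definition ehom_map (N N' : pmod) (t : pmhom N N') :
  hom (end_ob M N) (end_ob M N') := end_lift (ehom_wedge t).

Lemma ehom_mapE (N N' : pmod) (t : pmhom N N') a :
  end_proj M N' a \c ehom_map t =
  ihom_map (idm (M a)) (t a) \c end_proj M N a.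
Proof. exact: end_liftK. Qed.

Definition enriched_hom : additive_functor (pmodCat P C) C.
Proof.
apply: (@AdditiveFunctor (pmodCat P C) C (end_ob M) ehom_map).
- move=> N; apply: end_joint => a.
  by rewrite ehom_mapE ihom_map1 comp1m compm1.
- move=> N N' N'' g f; apply: end_joint => a.
  by rewrite compA !ehom_mapE -compA ehom_mapE compA -ihom_mapM comp1m.
- move=> N N' f g; apply: end_joint => a.
  by rewrite compDr !ehom_mapE ihom_mapD compDl.
Defined.

End Functor.

Variable EI : enough_injectives C.

Definition Ext (d : nat) (M N : pmod) : C :=
  right_derived (pmod_enough_injectives EI) (enriched_hom M) d N.

End EnrichedHom.

Section Grothendieck.
Variable C : preaddCat.

Definition free_class (A : C) : {freeg {classic C} / int} := << (A : {classic C}) >>.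

(* The free group is on objects; K0_iso makes the classes depend only on
   isomorphism classes. *)
Inductive K0_relation : {freeg {classic C} / int} -> Prop :=
  | K0_iso (A B : C) (f : hom A B) :
      is_iso f -> K0_relation (free_class A - free_class B)
  | K0_short_exact (A B D : C) (f : hom A B) (g : hom B D) :
      short_exact f g ->
      K0_relation (free_class B - (free_class A + free_class D))
  | K0_zero : K0_relation 0
  | K0_sub x y : K0_relation x -> K0_relation y -> K0_relation (x - y).

Definition K0_pred : {pred {freeg {classic C} / int}} :=
  fun x => `[< K0_relation x >].

Fact K0_pred_closed : zmod_closed K0_pred.
Proof.
split=> [|x y /asboolP rx /asboolP ry]; apply/asboolP.
  exact: K0_zero.
exact: K0_sub.
Qed.
HB.instance Definition _ := GRing.isZmodClosed.Build _ K0_pred K0_pred_closed.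

Definition K0_subgroup : zmodClosed {freeg {classic C} / int} := K0_pred.

Definition K0 : zmodType := Quotient.quot K0_subgroup.

Definition K0_class (A : C) : K0 := (\pi_K0 (free_class A))%qT.

End Grothendieck.

Section EulerChar.
Context {disp : Order.disp_t} (P : finPOrderType disp).

Definition unit_indicator (C : abelianCat) (V : closedSymMonoidal C)
    (Z : {set P}) (spreadZ : is_spread Z) : pmod P C :=
  indicator (munit V) spreadZ.

(* The sum over an infinite set is 0 by convention when infinitely many terms
   are nonzero, so the value is meaningful when Ext d M N vanishes for d large. *)
Definition euler_char (C : abelianCat) (V : closedSymMonoidal C)
    (EI : enough_injectives C) (M N : pmod P C) : K0 C :=
  (\sum_(d \in [set: nat]) K0_class (Ext V EI d M N) *~ (-1) ^+ d)%R.

(* A d-simplex a_0 < ... < a_d is the tuple of its vertices in increasing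
   order, hence min = first entry and max = last entry. *)
Definition order_complex (d : nat) : {set d.+1.-tuple P} :=
  [set s : d.+1.-tuple P | sorted <%O s].

Definition simplex_min (d : nat) (s : d.+1.-tuple P) : P := tnth s ord0.
Definition simplex_max (d : nat) (s : d.+1.-tuple P) : P := tnth s ord_max.

End EulerChar.

(* Main.v *)
From mathcomp Require Import all_boot all_order all_algebra.
From mathcomp Require Import boolp classical_sets fsbigop.
Require Import Defs.

Set Implicit Arguments.
Unset Strict Implicit.
Unset Printing Implicit Defensive.

Import Order.TTheory GRing.Theory.
Local Open Scope ring_scope.

(** A section of [M] over a spread [Z] is a compatible family of elements of the
    [M a], [a] in [Z], killed by every map that leaves [Z]; the enriched hom
    from [1_Z] to [M] is the object of such sections ([ehom_eval_universal]).
    Elements of [M a] are morphisms into [M a], and surjectivity means lifting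
    after composition with an epimorphism ([epi_cover], [cover_epi]).

    Call [M] flabby at [b] if [M b] maps onto the sections over the elements
    strictly above [b].  Three facts carry the proof.

    - The enriched hom is exact on a short exact sequence whose first term is
      flabby: sections of the quotient are lifted one element of [Z] at a time,
      from above ([flabby_section_lift]).

    - If [M] is flabby and [b] is minimal in [Z], restricting sections from [Z]
      to [Z] without [b] is epi, with the same kernel as the epimorphism from
      [M b] to the sections above [b].  So the classes of the section objects
      satisfy the recursion of the alternating sum over chains according to
      their least vertex, and the formula holds for the sections of a flabby
      module without any derived functor ([class_flabby]).

    - Injective modules are flabby ([injective_flabby]), and passing to a
      cosyzygy of an injective resolution makes a module flabby one level
      further down in [P], so that all cosyzygies from [#|P|] on are flabby
      ([cosyzygy_flabby]).

    The first and third facts make Ext vanish above degree [#|P|].  Up to it,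
    the class of each Ext object is an alternating sum of classes of kernels
    and of sections of injectives ([ext_class]).  The right-hand side of the
    formula is additive in the classes of the stalks, so the contributions of
    the cosyzygies telescope to that of [N] itself ([ext_partial_sum]). *)

(** * Epimorphisms in an abelian category *)

Section Epimorphisms.
Variable C : abelianCat.

Lemma is_mono_eq0 (A B : C) (f : hom A B) :
  (forall X (u : hom X A), f \c u = 0 -> u = 0) -> is_mono f.
Proof.
move=> f0 X u v fuv; apply/eqP; rewrite -subr_eq0; apply/eqP/f0.
by rewrite compBr fuv subrr.
Qed.

Lemma is_epi_eq0 (A B : C) (f : hom A B) :
  (forall X (u : hom B X), u \c f = 0 -> u = 0) -> is_epi f.
Proof.
move=> f0 X u v fuv; apply/eqP; rewrite -subr_eq0; apply/eqP/f0.
by rewrite compBl fuv subrr.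
Qed.

Lemma iso_epi (A B : C) (f : hom A B) : is_iso f -> is_epi f.
Proof.
by move=> [g [_ fg]] X u v uv; rewrite -[u]compm1 -[v]compm1 -fg !compA uv.
Qed.

Lemma epi_comp (A B D : C) (g : hom B D) (f : hom A B) :
  is_epi g -> is_epi f -> is_epi (g \c f).
Proof. by move=> eg ef X u v; rewrite !compA => /ef /eg. Qed.

Lemma epi_idm (A : C) : is_epi (idm A).
Proof. by move=> X u v; rewrite !compm1. Qed.

Lemma epi_kernel_cokernel (K A B : C) (k : hom K A) (f : hom A B) :
  is_epi f -> is_kernel k f -> is_cokernel f k.
Proof. by move=> /(ab_epi (acatP C))[D [g gP]]; exact: cokernel_kernel gP. Qed.

(** The kernel of [f p1 - x p2 : A + X -> B] is the pullback of [f] and [x];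
    it maps onto [X] because [f p1 - x p2] is epi, hence the cokernel of its
    kernel.  This is what makes the element-wise arguments below legitimate: a
    morphism out of [X] plays the role of an element, and an epimorphism into
    [X] that of a choice of preimages. *)
Lemma epi_cover (A B X : C) (f : hom A B) (x : hom X B) : is_epi f ->
  exists Y (e : hom Y X) (y : hom Y A), is_epi e /\ f \c y = x \c e.
Proof.
move=> ef; pose T (b : bool) := if b then A else X.
have [pq pq0 _] := bipP T.
pose p1 : hom (bip_ob T) A := bip_proj T true.
pose p2 : hom (bip_ob T) X := bip_proj T false.
pose i1 : hom A (bip_ob T) := bip_inj T true.
pose i2 : hom X (bip_ob T) := bip_inj T false.
have p1i1 : p1 \c i1 = idm A := pq true.
have p2i2 : p2 \c i2 = idm X := pq false.
have p2i1 : p2 \c i1 = 0 by exact: (pq0 true false).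
pose h := f \c p1 - x \c p2.
have hi1 : h \c i1 = f.
  by rewrite compBl -!compA p1i1 p2i1 compm0 subr0 compm1.
have eh : is_epi h.
  apply: is_epi_eq0 => W u uh; apply: (epi_eq0 ef).
  by rewrite -hi1 compA uh comp0m.
have kP := kerP h; have [_ hu] := epi_kernel_cokernel eh kP.
exists (ker_ob h), (p2 \c ker h), (p1 \c ker h); split; last first.
  by have /eqP := kP.1; rewrite compBl subr_eq0 -!compA => /eqP.
apply: is_epi_eq0 => W u; rewrite compA => /hu[v [vh _]].
have v0 : v = 0.
  by apply: (epi_eq0 ef); rewrite -hi1 compA vh -compA p2i1 compm0.
by rewrite -[u]compm1 -p2i2 compA -vh v0 !comp0m.
Qed.

Lemma cover_epi (A B : C) (f : hom A B) :
  (exists Y (e : hom Y B) (y : hom Y A), is_epi e /\ f \c y = e) -> is_epi f.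
Proof.
move=> [Y [e [y [ee fy]]]]; apply: is_epi_eq0 => X u uf.
by apply: (epi_eq0 ee); rewrite -fy compA uf comp0m.
Qed.

(** A subobject through which both [f] and its image factor is the whole image:
    [j] below is the kernel of a test map killing [p], and [k j] is a kernel
    itself, so it contains the image [K] of [f]. *)
Lemma image_epi (A B K : C) (f : hom A B) (k : hom K B) (p : hom A K) :
  is_image k f -> k \c p = f -> is_epi p.
Proof.
move=> [Q [q [[_ qu] kq]]] kp; apply: is_epi_eq0 => X u up.
have mk := kernel_mono kq; have [qk _] := kq.
have jP := kerP u; have [p' [jp _]] := jP.2 _ _ up.
have mkj := mono_comp mk (kernel_mono jP).
have [D [g [gkj gu]]] := ab_mono (acatP C) mkj.
have gf : g \c f = 0 by rewrite -kp -jp [k \c _]compA compA gkj comp0m.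
have [g' [g'q _]] := qu _ _ gf.
have gk : g \c k = 0 by rewrite -g'q -compA qk compm0.
have [t [kjt _]] := gu _ _ gk.
have jt : ker u \c t = idm K by apply: mk; rewrite compA kjt compm1.
by rewrite -[u]compm1 -jt compA jP.1 comp0m.
Qed.

Lemma exact_lift_epi (A B D K : C) (f : hom A B) (g : hom B D) (k : hom K B)
    (p : hom A K) : exact_at f g -> is_kernel k g -> k \c p = f -> is_epi p.
Proof.
move=> [K' [k' [im kg']]] kg kp.
have [v [vE _]] := kg'.2 _ _ kg.1; have [w [wE _]] := kg.2 _ _ kg'.1.
have vp : is_epi (v \c p) by apply: (image_epi im); rewrite compA vE.
have wv : w \c v = idm K.
  by apply: (kernel_mono kg); rewrite compA wE vE compm1.
move=> X s t spt.
have : (s \c w) \c (v \c p) = (t \c w) \c (v \c p).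
  by rewrite -!compA [w \c _]compA wv comp1m.
move/vp => sw; rewrite -[s]compm1 -[t]compm1 -wv !compA sw //.
Qed.

Lemma kernel_epi_short_exact (A B D : C) (f : hom A B) (g : hom B D) :
  is_kernel f g -> is_epi g -> short_exact f g.
Proof.
move=> fg eg; split=> //; first exact: kernel_mono fg.
by exists A, f; split=> //; exists D, g; split=> //; exact: epi_kernel_cokernel.
Qed.

Lemma coker_epi_zero (A B : C) (f : hom A B) :
  is_epi f -> is_zero (coker_ob f).
Proof.
move=> ef; apply: (cokernel_epi (cokerP f)); rewrite comp0m comp1m.
exact: (epi_eq0 ef) (cokerP f).1.
Qed.

End Epimorphisms.

(** * Classes in the Grothendieck group *)

Section GrothendieckClasses.
Variable C : abelianCat.
Local Notation "[ A ]" := (K0_class (A : C)).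

Lemma K0_class_iso (A B : C) (f : hom A B) : is_iso f -> [A] = [B].
Proof.
move=> fi; apply/eqP; rewrite -Quotient.idealrBE.
by apply/asboolP; exact: K0_iso fi.
Qed.

Lemma K0_class_short_exact (A B D : C) (f : hom A B) (g : hom B D) :
  is_kernel f g -> is_epi g -> [B] = [A] + [D].
Proof.
move=> fg eg; rewrite /K0_class -[RHS]raddfD; apply/eqP.
rewrite -Quotient.idealrBE; apply/asboolP.
exact: K0_short_exact (kernel_epi_short_exact fg eg).
Qed.

Lemma K0_class_zero (A : C) : is_zero A -> [A] = 0.
Proof.
move=> zA; apply: (addrI [A]); rewrite addr0; apply/esym.
apply: (@K0_class_short_exact A A A (idm A) (idm A)); last exact: epi_idm.
split; first by rewrite compm1.
by move=> X x _; exists x; split=> [|u]; rewrite comp1m.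
Qed.

Lemma kernel_iso (K K' A B : C) (k : hom K A) (k' : hom K' A) (f : hom A B) :
  is_kernel k f -> is_kernel k' f -> exists t : hom K K', is_iso t.
Proof.
move=> kP kP'; have [t [tE _]] := kP'.2 _ _ kP.1.
have [s [sE _]] := kP.2 _ _ kP'.1.
exists t, s; split.
  by apply: (kernel_mono kP); rewrite compA sE tE compm1.
by apply: (kernel_mono kP'); rewrite compA tE sE compm1.
Qed.

Lemma K0_class_kernel (K K' A B : C) (k : hom K A) (k' : hom K' A)
    (f : hom A B) : is_kernel k f -> is_kernel k' f -> [K] = [K'].
Proof. by move=> kP /(kernel_iso kP)[t] /K0_class_iso. Qed.

(** Both differences equal the class of the image of [f]. *)
Lemma K0_class_ker_coker (K A B : C) (k : hom K A) (f : hom A B) :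
  is_kernel k f -> [A] - [K] = [B] - [coker_ob f].
Proof.
move=> kP; have qP := cokerP f; have iP := kerP (coker f).
have [p [pE _]] := iP.2 _ _ qP.1.
have ep : is_epi p.
  by apply: (image_epi _ pE); exists (coker_ob f), (coker f).
have kp : is_kernel k p.
  split; first by apply: (kernel_mono iP); rewrite compA pE kP.1 compm0.
  by move=> X x px; apply: kP.2; rewrite -pE -compA px compm0.
rewrite (K0_class_short_exact kp ep).
by rewrite (K0_class_short_exact iP (cokernel_epi qP)) addrC addKr addrK.
Qed.

End GrothendieckClasses.

(** * Sections of a module over a set of poset elements *)

Section Sections.
Context {disp : Order.disp_t} (P : finPOrderType disp) (C : abelianCat).
Local Notation pmod := (pmod P C).

(** For a spread [Z] these are, written out, the morphisms from [1_Z] tensored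
    with [X] to [M]. *)
Definition is_section (Z : {set P}) (M : pmod) (X : C)
    (x : forall a, hom X (M a)) :=
  (forall a, a \notin Z -> x a = 0) /\
  (forall a b (ab : (a <= b)%O), a \in Z -> pm_map M ab \c x a = x b).

Definition is_universal_section (Z : {set P}) (M : pmod) (S : C)
    (s : forall a, hom S (M a)) :=
  is_section Z s /\
  forall X (x : forall a, hom X (M a)), is_section Z x ->
  exists! u : hom X S, forall a, s a \c u = x a.

Definition above (b : P) : {set P} := [set c | (b < c)%O].

Lemma above_spread b : is_spread (above b).
Proof. by move=> x y z; rewrite !inE => bx _ xy _; exact: lt_le_trans xy. Qed.

Definition minimal_in (Z : {set P}) (b : P) :=
  b \in Z /\ forall c, c \in Z -> (c < b)%O = false.

Lemma minimal_in_ex (Z : {set P}) : Z != finset.set0 -> exists b, minimal_in Z b.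
Proof.
move=> /set0Pn[z zZ].
have [b bZ bm] := arg_minnP (fun b => #|[set c in Z | (c < b)%O]|) zZ.
exists b; split=> // c cZ; apply/negP => cb.
have := bm c cZ; rewrite leqNgt => /negP; case.
apply: proper_card; apply/properP; split.
  apply/fintype.subsetP => d; rewrite !inE => /andP[-> dc].
  exact: lt_trans cb.
by exists c; rewrite !inE cZ ?cb // ltxx.
Qed.

Lemma spread_remove_minimal (Z : {set P}) b :
  is_spread Z -> minimal_in Z b -> is_spread (Z :\ b).
Proof.
move=> sZ [_ bm] x y z; rewrite !inE => /andP[xb xZ] /andP[zb zZ] xy yz.
rewrite (sZ x y z) // andbT; apply/eqP => yb; subst y.
by have := bm x xZ; rewrite lt_neqAle xb xy.
Qed.

Section Families.
Variables (M : pmod) (X : C).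
Implicit Types (x : forall a, hom X (M a)) (Z W : {set P}).

Lemma section_comp Z x Y (e : hom Y X) :
  is_section Z x -> is_section Z (fun a => x a \c e).
Proof.
move=> [x0 xm]; split=> [a /x0->|a b ab aZ]; first exact: comp0m.
by rewrite compA xm.
Qed.

Lemma section_map Z x (N : pmod) (t : pmhom M N) :
  is_section Z x -> is_section Z (fun a => t a \c x a).
Proof.
move=> [x0 xm]; split=> [a /x0->|a b ab aZ]; first exact: compm0.
by rewrite compA pm_nat -compA xm.
Qed.

Definition cut (W : {set P}) x : forall a, hom X (M a) :=
  fun a => if a \in W then x a else 0.

(** The hypothesis on [Z] and [W] is what makes the map from [1_W] to [1_Z]
    that is the identity on the intersection natural.  It covers both
    restriction to the complement of a minimal element [b] and extension by
    zero from there to the elements above [b]. *)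
Lemma section_cut Z W x :
  (forall a c, (a <= c)%O -> a \in W -> c \in Z -> (a \in Z) && (c \in W)) ->
  is_section Z x -> is_section W (cut W x).
Proof.
move=> ZW [x0 xm]; split=> [a|a c ac aW]; rewrite /cut; first by case: ifP.
rewrite aW; have [cZ|cZ] := boolP (c \in Z).
  by have /andP[aZ ->] := ZW a c ac aW cZ; rewrite xm.
rewrite (x0 _ cZ) if_same; have [aZ|aZ] := boolP (a \in Z).
  by rewrite (xm a c) // x0.
by rewrite (x0 _ aZ) compm0.
Qed.

Lemma section_remove Z b x :
  minimal_in Z b -> is_section Z x -> is_section (Z :\ b) (cut (Z :\ b) x).
Proof.
move=> [bZ bm]; apply: section_cut => a c ac; rewrite !inE => /andP[ab aZ] cZ.
rewrite aZ cZ andbT /=; apply: contraTN ac => /eqP->.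
by apply/negP => acb; have := bm a aZ; rewrite lt_neqAle ab acb.
Qed.

Lemma section_above Z b x : is_spread Z -> b \in Z ->
  is_section (Z :\ b) x -> is_section (above b) (cut (above b) x).
Proof.
move=> sZ bZ; apply: section_cut => a c ac; rewrite !inE => ba /andP[_ cZ].
rewrite (gt_eqF ba) (lt_le_trans ba ac) andbT /=.
exact: sZ bZ cZ (ltW ba) ac.
Qed.

Lemma section_sub Z x x' : is_section Z x -> is_section Z x' ->
  is_section Z (fun a => x a - x' a).
Proof.
move=> [x0 xm] [x0' xm']; split=> [a aZ|a b ab aZ].
  by rewrite x0 // x0' // subrr.
by rewrite compBr xm // xm'.
Qed.

(** Extended by [0] to a family on all of [P], so that it can be [cut]. *)
Definition push b (y : hom X (M b)) : forall a, hom X (M a) :=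
  fun a => if @idP (b <= a)%O is ReflectT ba then pm_map M ba \c y else 0.

Lemma pushE b (y : hom X (M b)) a (ba : (b <= a)%O) :
  push y a = pm_map M ba \c y.
Proof.
rewrite /push; case: {-}_ / idP => // ba'.
by rewrite (bool_irrelevance ba' ba).
Qed.

Lemma section_push b (y : hom X (M b)) :
  is_section (above b) (cut (above b) (push y)).
Proof.
split=> [a|a c ac]; rewrite /cut; first by case: ifP.
rewrite !inE => ba; have bc := lt_le_trans ba ac.
by rewrite ba bc (pushE _ (ltW ba)) (pushE _ (ltW bc)) compA
  (pm_comp _ (ltW ba) ac (ltW bc)).
Qed.

Lemma section_glue Z b x (y : hom X (M b)) : minimal_in Z b ->
  is_section (Z :\ b) x ->
  (forall c (bc : (b <= c)%O), c \in above b -> pm_map M bc \c y = x c) ->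
  is_section Z (dfwith x y).
Proof.
move=> [bZ bm] [x0 xm] yx; split=> [a aZ|a c ac aZ].
  rewrite dfwith_out; first by rewrite x0 // !inE (negPf aZ) andbF.
  by apply: contraNneq aZ => <-.
case: (eqVneq b a) ac => [<- bc|ba ac].
  case: (eqVneq b c) bc => [<- bb|nbc bc].
    by rewrite dfwith_in pm_id comp1m.
  by rewrite dfwith_in dfwith_out // yx // inE lt_neqAle nbc.
rewrite !dfwith_out ?xm // ?inE; first by rewrite eq_sym ba.
apply: contraTneq ac => <-; apply/negP => ab.
by have := bm a aZ; rewrite lt_neqAle eq_sym ba ab.
Qed.

End Families.

(** * Flabby modules *)

(** Since an epimorphism in [C] need not split, sections are asked to extend to
    [b] only after composition with an epimorphism [e]. *)
Definition flabby_at (M : pmod) (b : P) :=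
  forall X (x : forall a, hom X (M a)), is_section (above b) x ->
  exists Y (e : hom Y X) (y : hom Y (M b)), is_epi e /\
  forall c (bc : (b <= c)%O), c \in above b -> pm_map M bc \c y = x c \c e.

(** Adjoin the elements of [Z] one at a time from above.  When a lift [y] is
    known away from the minimal element [b], any lift [w] of the value at [b]
    fails to be compatible with [y] by a section over [above b] of the kernel
    [M]; as [M] is flabby at [b], this defect extends to [b] and can be
    subtracted from [w]. *)
Lemma flabby_section_lift (M A B : pmod) (f : pmhom M A) (g : pmhom A B) :
  (forall a, is_kernel (f a) (g a)) -> (forall a, is_epi (g a)) ->
  forall Z : {set P}, is_spread Z -> (forall b, b \in Z -> flabby_at M b) ->
  forall X (x : forall a, hom X (B a)), is_section Z x ->
  exists Y (e : hom Y X) (y : forall a, hom Y (A a)),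
    [/\ is_epi e, is_section Z y & forall a, g a \c y a = x a \c e].
Proof.
move=> ker_fg epi_g Z; move: {2}#|Z| (erefl #|Z|) => n.
elim: n Z => [|n IH] Z.
  move=> /eqP; rewrite cards_eq0 => /eqP-> _ _ X x [x0 _].
  exists X, (idm X), (fun=> 0); split; first exact: epi_idm.
    by split=> // a b ab; rewrite inE.
  by move=> a; rewrite compm0 x0 ?inE // comp0m.
move=> cZ sZ fl X x xs.
have [|b bm] := @minimal_in_ex Z; first by rewrite -card_gt0 cZ.
have bZ := bm.1.
have cZ' : #|Z :\ b| = n by move: cZ; rewrite (cardsD1 b) bZ => -[].
have [|Y1 [e1 [y1 [ee1 y1s y1E]]]] := IH _ cZ' (spread_remove_minimal sZ bm)
  _ _ _ (section_remove bm xs).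
  by move=> c; rewrite inE => /andP[_]; exact: fl.
have y1E' a : a != b -> g a \c y1 a = x a \c e1.
  move=> ab; rewrite y1E /cut !inE ab /=; case: ifPn => // aZ.
  by rewrite xs.1.
have [Y2 [e2 [w [ee2 wE]]]] := epi_cover (x b \c e1) (epi_g b).
pose y2 c := y1 c \c e2; have y2s := section_comp e2 y1s.
pose d c := cut (above b) (push w) c - cut (above b) y2 c.
have ds : is_section (above b) d.
  exact: section_sub (section_push w) (section_above sZ bZ y2s).
have dE c (bc : (b <= c)%O) : c \in above b -> d c = pm_map A bc \c w - y2 c.
  by move=> cb; rewrite /d /cut cb (pushE _ bc).
have gd c : g c \c d c = 0.
  have [cb|/ds.1->] := boolP (c \in above b); last exact: compm0.
  have bc : (b <= c)%O by move: cb; rewrite inE => /ltW.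
  have cb' : c != b by move: cb; rewrite inE => /gt_eqF->.
  rewrite (dE c bc cb) compBr compA -pm_nat -!compA wE !compA y1E' //.
  by rewrite xs.2 // subrr.
pose m c := projT1 (cid ((ker_fg c).2 _ _ (gd c))).
have mE c : f c \c m c = d c by rewrite /m; case: cid => u [].
have ms : is_section (above b) m.
  split=> [c cb|c c' cc' cb]; apply: (kernel_mono (ker_fg _)).
    by rewrite mE compm0 ds.1.
  by rewrite compA -pm_nat -compA !mE ds.2.
have [Y3 [e3 [v [ee3 vE]]]] := fl b bZ _ _ ms.
have fvE c (bc : (b <= c)%O) : c \in above b ->
    pm_map A bc \c (w \c e3 - f b \c v) = y2 c \c e3.
  move=> cb; rewrite compBr [pm_map A bc \c (f b \c v)]compA pm_nat -compA.
  by rewrite vE // [f c \c _]compA mE (dE c bc cb) compBl -compA opprB addrC subrK.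
exists Y3, (e1 \c e2 \c e3), (dfwith (fun c => y2 c \c e3) (w \c e3 - f b \c v)).
split.
- by apply: epi_comp ee3; exact: epi_comp.
- by apply: section_glue => //; exact: section_comp.
- move=> a; case: (eqVneq b a) => [<-|ba].
    rewrite dfwith_in compBr [g b \c (f b \c v)]compA (ker_fg b).1 comp0m subr0.
    by rewrite !compA wE.
  by rewrite dfwith_out // /y2 !compA y1E' // eq_sym.
Qed.

(** A section over [above b] is a morphism from the indicator of [above b];
    injectivity extends it to the indicator of the elements [>= b], and the
    value of the extension at [b] is the lift. *)
Lemma injective_flabby (J : pmod) b :
  @injective_ob (pmodCat P C) J -> flabby_at J b.
Proof.
move=> injJ X x [x0 xm].
have up_spread : is_spread [set c | (b <= c)%O].
  by move=> u v w; rewrite !inE => bu _ uv _; exact: le_trans uv.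
pose U := indicator X (@above_spread b); pose W := indicator X up_spread.
have cU c : c \in above b -> c \in [set c | (b <= c)%O].
  by rewrite !inE => /ltW.
have i_nat a c (ac : (a <= c)%O) :
    pm_map W ac \c ind_map X (a \in above b) (a \in [set c | (b <= c)%O]) =
    ind_map X (c \in above b) (c \in [set c | (b <= c)%O]) \c pm_map U ac.
  apply: etrans (ind_map_comp _ _) (esym (ind_map_comp _ _)) => [/cU //|].
  by rewrite !inE => /lt_le_trans->.
pose out a : hom (U a) X := ind_map X (a \in above b) true.
have h_nat a c (ac : (a <= c)%O) :
    pm_map J ac \c (x a \c out a) = (x c \c out c) \c pm_map U ac.
  rewrite -[RHS]compA; have -> : out c \c pm_map U ac = out a.
    have aU : a \in above b -> true -> c \in above b.
      by rewrite !inE => /lt_le_trans->.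
    exact: (ind_map_comp X aU).
  rewrite [LHS]compA; case: (pselect (a \in above b)) => [aU|/negP aU].
    by rewrite xm.
  have -> : out a = 0.
    have ind0 (t : bool) : ~~ t -> ind_map X t true = 0 by case: t.
    exact: ind0.
  by rewrite !compm0.
pose i : pmhom U W := @PMHom _ _ _ U W (fun a => ind_map X _ _) i_nat.
pose h : pmhom U J := @PMHom _ _ _ U J (fun a => x a \c out a) h_nat.
have mi : @is_mono (pmodCat P C) _ _ i.
  apply: pm_pointwise_mono => a /=; move: (@cU a).
  case: (a \in above b) => [/(_ isT)->|_]; apply: is_mono_eq0 => Y u.
    by rewrite comp1m.
  by rewrite -[u]comp1m zero_obP !comp0m.
have [H Hi] := injJ U W i h mi.
have HiE a : (H : pmhom W J) a \c i a = h a.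
  by rewrite -[LHS]/(pm_fun (H \c (i : hom (U : pmodCat P C) W)) a) Hi.
exists X, (idm X), ((H : pmhom W J) b \c ind_map X true (b \in [set c | (b <= c)%O])).
split=> [|c bc cb]; first exact: epi_idm.
have HW : pm_map J bc \c (H : pmhom W J) b = (H : pmhom W J) c \c pm_map W bc.
  exact: pm_nat.
have bW : pm_map W bc \c ind_map X true (b \in [set c | (b <= c)%O]) =
    ind_map X true (c \in [set c | (b <= c)%O]).
  by apply: ind_map_comp => _ _; rewrite inE.
have bU : i c \c ind_map X true (c \in above b) =
    ind_map X true (c \in [set c | (b <= c)%O]).
  by apply: ind_map_comp.
rewrite compA HW -compA bW -bU compA HiE compm1.
have oc : out c \c ind_map X true (c \in above b) = idm X.
  by apply: (@ind_map_comp _ X true _ true).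
by rewrite /= -compA oc compm1.
Qed.

End Sections.

(** * The enriched hom out of an indicator module *)

Section EnrichedSections.
Variables (C : abelianCat) (V : closedSymMonoidal C).
Local Notation ihom := (ihom V).
Local Notation ihom_map := (ihom_map V).
Local Notation I := (munit V).

Definition mrunit_inv (A : C) : hom A (tens V A I) :=
  projT1 (cid (mrunit_iso V A)).

Lemma mrunit_invK (A : C) : mrunit_inv A \c mrunit A = idm (tens V A I).
Proof. by rewrite /mrunit_inv; case: cid => g []. Qed.

Definition ihom_unit (B : C) : hom (ihom I B) B :=
  ihom_ev V I B \c mrunit_inv (ihom I B).

Definition ihom_unit_inv (B : C) : hom B (ihom I B) := ihom_curry V (mrunit B).

Lemma ihom_unitE (B : C) : ihom_unit B \c mrunit (ihom I B) = ihom_ev V I B.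
Proof. by rewrite /ihom_unit -compA mrunit_invK compm1. Qed.

Lemma ihom_unitK (B : C) : ihom_unit_inv B \c ihom_unit B = idm (ihom I B).
Proof.
apply: ihom_joint; rewrite tensm1 compm1 -[X in _ \otm X]comp1m tensmM compA.
by rewrite ihom_curryK mrunit_nat ihom_unitE.
Qed.

Lemma ihom_unit_invK (B : C) : ihom_unit B \c ihom_unit_inv B = idm B.
Proof.
apply: (iso_epi (mrunit_iso V B)).
by rewrite -compA -mrunit_nat compA ihom_unitE ihom_curryK comp1m.
Qed.

Lemma ihom_unit_nat (B B' : C) (g : hom B B') :
  ihom_unit B' \c ihom_map (idm I) g = g \c ihom_unit B.
Proof.
apply: (iso_epi (mrunit_iso V (ihom I B))).
rewrite -[LHS]compA -(mrunit_nat V (ihom_map _ _)) [LHS]compA -[RHS]compA.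
rewrite !ihom_unitE -[ihom_map _ _]compm1 ihom_ev_map.
by rewrite tensm1 compm1.
Qed.

Lemma ihom_zero_joint (B X : C) (u v : hom X (ihom (zero_ob C) B)) : u = v.
Proof.
apply: ihom_joint; rewrite -[LHS]compm1 -[RHS]compm1 -!(braidK V) ![LHS]compA.
rewrite ![RHS]compA; congr (_ \c _); exact: tens_zero.
Qed.

(** Evaluation at the point: on the stalks of an indicator module this is
    [Hom(1, B) = B] or [Hom(0, B) = 0]. *)
Definition ind_eval (t : bool) (B : C) : hom (ihom (ind_ob I t) B) B :=
  ihom_unit B \c ihom_map (ind_map I true t) (idm B).

Definition ind_eval_inv (t : bool) (B : C) : hom B (ihom (ind_ob I t) B) :=
  ihom_map (ind_map I t true) (idm B) \c ihom_unit_inv B.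

Lemma ind_eval_mono t B : is_mono (ind_eval t B).
Proof.
case: t => X u v; last by move=> _; exact: ihom_zero_joint.
rewrite /ind_eval /= ihom_map1 compm1 => uv.
by rewrite -[u]comp1m -[v]comp1m -ihom_unitK -[LHS]compA uv compA.
Qed.

Lemma ind_eval_invK B : ind_eval true B \c ind_eval_inv true B = idm B.
Proof.
by rewrite /ind_eval /ind_eval_inv /= ihom_map1 compm1 comp1m ihom_unit_invK.
Qed.

Lemma ind_eval_false B : ind_eval false B = 0.
Proof.
rewrite -[LHS]compm1 (ihom_zero_joint (idm _) 0); exact: compm0.
Qed.

Lemma ind_eval_nat t (B B' : C) (g : hom B B') :
  ind_eval t B' \c ihom_map (idm _) g = g \c ind_eval t B.
Proof.
rewrite /ind_eval -[LHS]compA -ihom_mapM !comp1m [RHS]compA -ihom_unit_nat.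
by rewrite -[RHS]compA -ihom_mapM !compm1.
Qed.

Lemma ind_eval_map t B :
  ind_eval true B \c ihom_map (ind_map I true t) (idm B) = ind_eval t B.
Proof. by rewrite /ind_eval /= ihom_map1 compm1. Qed.

Context {disp : Order.disp_t} (P : finPOrderType disp).
Variables (Z : {set P}) (spreadZ : is_spread Z).
Local Notation pmod := (pmod P C).
Local Notation one := (unit_indicator V spreadZ).

Lemma wedge_section (M : pmod) (X : C)
    (x : forall a : P, hom X (ihom (one a) (M a))) :
  is_wedge x <-> is_section Z (fun a => ind_eval (a \in Z) (M a) \c x a).
Proof.
have key a b (ab : (a <= b)%O) :
    (ihom_map (idm (one a)) (pm_map M ab) \c x a =
     ihom_map (pm_map one ab) (idm (M b)) \c x b) <->
    (a \in Z -> pm_map M ab \c (ind_eval (a \in Z) (M a) \c x a) =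
                ind_eval (b \in Z) (M b) \c x b).
  rewrite [pm_map M ab \c _]compA -ind_eval_nat -compA.
  rewrite /=; move: (x a) (x b) => /=.
  case: (a \in Z) => /= u v; last by split=> // _; exact: ihom_zero_joint.
  rewrite -(ind_eval_map (b \in Z)) -[(_ \c _) \c v]compA.
  by split=> [->//|/(_ isT) h]; exact: (@ind_eval_mono true _ _ _ _ h).
split=> [w|[_ xm] a b ab]; last by apply/key => aZ; exact: xm.
split=> [a|a b ab aZ]; last by apply: (key a b ab).1.
move: (x a) => /=; case: (a \in Z) => // u _.
by rewrite ind_eval_false comp0m.
Qed.

Definition ehom_eval (M : pmod) a : hom (enriched_hom V one M) (M a) :=
  ind_eval (a \in Z) (M a) \c end_proj V one M a.

Lemma ehom_eval_universal (M : pmod) :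
  is_universal_section Z (@ehom_eval M).
Proof.
have [pw pu] := endP V one M.
split; first exact: (wedge_section (end_proj V one M)).1.
move=> X y ys.
pose x a : hom X (ihom (one a) (M a)) := ind_eval_inv (a \in Z) (M a) \c y a.
have xE a : ind_eval (a \in Z) (M a) \c x a = y a.
  rewrite /x; have := ys.1 a; case: (a \in Z) => y0.
    by rewrite compA ind_eval_invK comp1m.
  by rewrite y0 // !compm0.
have xw : is_wedge x.
  apply/wedge_section; split=> [a aZ|a b ab aZ]; first by rewrite xE ys.1.
  by rewrite !xE ys.2.
have [u [uE uu]] := pu X x xw; exists u; split=> [a|v vE].
  by rewrite /ehom_eval -compA uE xE.
apply: uu => a; apply: (@ind_eval_mono (a \in Z)).
by rewrite xE -vE /ehom_eval compA.
Qed.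

Lemma ehom_eval_nat (M N : pmod) (t : pmhom M N) a :
  ehom_eval N a \c fmap (enriched_hom V one) (t : @hom (pmodCat P C) M N) =
  t a \c ehom_eval M a.
Proof.
rewrite /ehom_eval -compA [end_proj V one N a \c _]ehom_mapE.
by rewrite [LHS]compA ind_eval_nat -[LHS]compA.
Qed.

End EnrichedSections.

(** * Alternating sums over chains *)

Section ChainSums.
Context {disp : Order.disp_t} (P : finPOrderType disp).
Variable K : zmodType.
Implicit Types (f g h : P -> K) (Z : {set P}).

Definition chain_sum f d b : K :=
  \sum_(s in order_complex P d | simplex_min s == b) f (simplex_max s).

(** Degrees up to [#|P|], one more than a chain in [P] can have: removing the
    least vertex lowers the degree by one, and the spare degree lets both sides
    of the resulting recursion be sums with the same bound. *)
Definition local_euler f b : K :=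
  \sum_(d < #|P|.+1) chain_sum f d b *~ (-1) ^+ d.

Definition euler_sum f Z : K := \sum_(b in Z) local_euler f b.

Lemma chain_sum0 f b : chain_sum f 0 b = f b.
Proof.
rewrite /chain_sum (big_pred1 [tuple b]) => [|s].
  by rewrite /simplex_max (tnth_nth b).
case/tupleP: s => x s; rewrite [s]tuple0 inE /simplex_min (tnth_nth b) /=.
by apply/eqP/eqP => [->|/(congr1 val) []] //; exact: val_inj.
Qed.

(** Remove the least vertex of the chain. *)
Lemma chain_sumS f d b :
  chain_sum f d.+1 b = \sum_(c in above b) chain_sum f d c.
Proof.
rewrite /chain_sum.
rewrite (reindex_onto (fun t : d.+1.-tuple P => [tuple of b :: t])
  (fun s : d.+2.-tuple P => [tuple of behead s])) /=; last first.
  move=> s; case/tupleP: s => x t /andP[_]; rewrite /simplex_min (tnth_nth b).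
  by move=> /eqP /= ->; exact: val_inj.
rewrite [LHS](_ : _ = \sum_(t in order_complex P d | (b < simplex_min t)%O)
                       f (simplex_max t)); last first.
  apply: eq_big => [t|t _]; last by rewrite /simplex_max !(tnth_nth b).
  rewrite !inE /simplex_min !(tnth_nth b) /= eqxx andbT.
  rewrite (_ : [tuple of _] == t); last by apply/eqP/val_inj.
  by case/tupleP: t => x t /=; rewrite andbT andbC.
rewrite (partition_big (@simplex_min _ P d) (mem (above b))) /= => [|t].
  apply: eq_bigr => c; rewrite inE => bc; apply: eq_bigl => t.
  by case: eqP => [->|_]; rewrite ?bc ?andbT ?andbF.
by case/andP=> _; rewrite inE.
Qed.

Lemma card_above_lt (b c : P) : c \in above b -> (#|above c| < #|above b|)%N.
Proof.
move=> cb; apply: proper_card; apply/properP; split; last first.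
  by exists c => //; rewrite inE ltxx.
apply/fintype.subsetP => a; rewrite !inE; apply: lt_trans.
by move: cb; rewrite inE.
Qed.

Lemma card_above_ltP (b : P) : (#|above b| < #|P|)%N.
Proof.
rewrite -cardsT; apply: proper_card; apply/properP; split.
  by apply/fintype.subsetP => a _; rewrite inE.
by exists b; rewrite inE // ltxx.
Qed.

Lemma chain_sum_eq0 f d b : (#|above b| < d)%N -> chain_sum f d b = 0.
Proof.
elim: d b => // d IH b bd; rewrite chain_sumS big1 // => c /card_above_lt cb.
by apply: IH; exact: leq_trans cb bd.
Qed.

Lemma local_eulerE f b :
  local_euler f b = f b - \sum_(c in above b) local_euler f c.
Proof.
rewrite /local_euler big_ord_recl expr0 mulr1z chain_sum0; congr (_ + _).
rewrite exchange_big /= big_ord_recr /= [X in _ = - (_ + X)]big1 => [|c _]; last first.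
  by rewrite chain_sum_eq0 ?mul0rz // card_above_ltP.
rewrite addr0 -sumrN; apply: eq_bigr => d _.
by rewrite chain_sumS exprS mulN1r mulrNz mulrz_suml.
Qed.

Lemma euler_sumD f g h Z : (forall a, h a = f a + g a) ->
  euler_sum h Z = euler_sum f Z + euler_sum g Z.
Proof.
move=> hE; rewrite -big_split; apply: eq_bigr => b _; rewrite -big_split.
apply: eq_bigr => d _; rewrite /= -mulrzDl; congr (_ *~ _).
by rewrite -big_split; apply: eq_bigr.
Qed.

Lemma fsum_nat_bounded (F : nat -> K) n :
  (forall d, (n <= d)%N -> F d = 0) -> \sum_(d \in [set: nat]) F d = \sum_(d < n) F d.
Proof.
move=> F0; rewrite fsbig_ord; apply/esym/fsbig_widen => // d [_ /= nd].
by apply: F0; rewrite leqNgt; apply/negP.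
Qed.

Lemma euler_sum_chains f Z :
  \sum_(d \in [set: nat])
    (\sum_(s in order_complex P d | simplex_min s \in Z)
       f (simplex_max s)) *~ (-1) ^+ d = euler_sum f Z.
Proof.
have E d : \sum_(s in order_complex P d | simplex_min s \in Z) f (simplex_max s)
    = \sum_(b in Z) chain_sum f d b.
  rewrite (partition_big (@simplex_min _ P d) (mem Z)) /= => [|s /andP[]//].
  apply: eq_bigr => b bZ; apply: eq_bigl => s.
  by case: eqP => [->|_]; rewrite ?bZ ?andbT ?andbF.
rewrite (@fsum_nat_bounded _ #|P|.+1) => [|d Pd].
  rewrite /euler_sum exchange_big /=; apply: eq_bigr => d _.
  by rewrite E mulrz_suml.
rewrite E big1 ?mul0rz // => b _; apply: chain_sum_eq0.
exact: leq_trans (card_above_ltP b) (ltnW Pd).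
Qed.

End ChainSums.

(** * The class of the sections of a flabby module *)

Section FlabbyClass.
Context {disp : Order.disp_t} (P : finPOrderType disp) (C : abelianCat).
Local Notation pmod := (pmod P C).
Local Notation "[ A ]" := (K0_class (A : C)).

Lemma universal_section_joint Z (M : pmod) S (s : forall a, hom S (M a)) :
  is_universal_section Z s ->
  forall X (u v : hom X S), (forall a, s a \c u = s a \c v) -> u = v.
Proof.
move=> [ss su] X u v uv; have [w [_ wu]] := su _ _ (section_comp v ss).
by rewrite -(wu u) // -(wu v).
Qed.

(** Restriction away from the minimal element [b] and restriction from [b] to
    the elements above it have the same kernel, namely the part of [M b] killed
    by the maps to all elements above [b]; both are epi when [M] is flabby at
    [b]. *)
Lemma class_remove_minimal (Z : {set P}) b (M : pmod) S S' T
    (s : forall a, hom S (M a)) (s' : forall a, hom S' (M a))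
    (t : forall a, hom T (M a)) :
  is_spread Z -> minimal_in Z b -> flabby_at M b ->
  is_universal_section Z s -> is_universal_section (Z :\ b) s' ->
  is_universal_section (above b) t ->
  [S] = [S'] + ([M b] - [T]).
Proof.
move=> sZ bm fl sU sU' tU; have bZ := bm.1.
have [r [rE _]] := sU'.2 _ _ (section_remove bm sU.1).
have [i [iE _]] := tU.2 _ _ (section_push (idm (M b))).
have iE' c (bc : (b <= c)%O) : c \in above b -> t c \c i = pm_map M bc.
  by move=> cb; rewrite iE /cut cb (pushE _ bc) compm1.
have ri a : a != b -> s' a \c r = s a.
  move=> ab; rewrite rE /cut !inE ab /=.
  by case: ifPn => // /sU.1.1.
have er : is_epi r.
  apply: cover_epi.
  have [Y [e [y [ee yE]]]] := fl _ _ (section_above sZ bZ sU'.1).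
  have ys : is_section Z (dfwith (fun a => s' a \c e) y).
    apply: section_glue bm (section_comp e sU'.1) _ => c bc cb.
    by rewrite yE // /cut cb.
  have [u [uE _]] := sU.2 _ _ ys.
  exists Y, e, u; split=> //; apply: (universal_section_joint sU') => a.
  have [->|ab] := eqVneq a b; first by rewrite !sU'.1.1 ?inE ?eqxx // !comp0m.
  by rewrite compA ri // uE dfwith_out // eq_sym.
have ei : is_epi i.
  apply: cover_epi; have [Y [e [y [ee yE]]]] := fl _ _ tU.1.
  exists Y, e, y; split=> //; apply: (universal_section_joint tU) => c.
  have [cb|cb] := boolP (c \in above b); last by rewrite !tU.1.1 // !comp0m.
  have bc : (b <= c)%O by move: cb; rewrite inE => /ltW.
  by rewrite compA (iE' _ bc cb) yE.
have kP := kerP i; set k := ker i in kP.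
have ks : is_section Z (dfwith (fun a => 0 : hom (ker_ob i) (M a)) k).
  apply: section_glue bm _ _ => [|c bc cb].
    by split=> // a c ac _; exact: compm0.
  by rewrite -(iE' _ bc cb) -compA kP.1 compm0.
have [j [jE _]] := sU.2 _ _ ks.
have sjb : s b \c j = k by rewrite jE dfwith_in.
have jP : is_kernel j r.
  split.
    apply: (universal_section_joint sU') => a; rewrite compm0.
    have [->|ab] := eqVneq a b; first by rewrite sU'.1.1 ?inE ?eqxx // comp0m.
    by rewrite compA ri // jE dfwith_out // eq_sym.
  move=> X x rx.
  have sx a : a != b -> s a \c x = 0.
    by move=> ab; rewrite -ri // -compA rx compm0.
  have isx : i \c (s b \c x) = 0.
    apply: (universal_section_joint tU) => c; rewrite compm0.
    have [cb|/tU.1.1->] := boolP (c \in above b); last by rewrite comp0m.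
    have cb' := cb; rewrite inE in cb'.
    rewrite compA (iE' _ (ltW cb') cb) compA sU.1.2 //.
    by rewrite sx // gt_eqF.
  have [u [uE _]] := kP.2 _ _ isx; exists u; split.
    apply: (universal_section_joint sU) => a.
    have [->|ab] := eqVneq a b; first by rewrite compA sjb.
    by rewrite compA jE dfwith_out ?comp0m ?sx // eq_sym.
  by move=> v jv; apply: (kernel_mono kP); rewrite uE -sjb -compA jv.
rewrite (K0_class_short_exact jP er) (K0_class_short_exact kP ei).
by rewrite addrK addrC.
Qed.

(** Removing the elements of [Z] one at a time writes the class as a sum over [Z]
    of local terms [e b]; applied to [above b] itself, this gives [e b] the
    recursion [local_eulerE] of the alternating chain sums. *)
Lemma class_flabby (V : closedSymMonoidal C) (M : pmod) :
  (forall b, flabby_at M b) ->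
  forall Z : {set P}, is_spread Z ->
  forall S (s : forall a, hom S (M a)), is_universal_section Z s ->
  [S] = euler_sum (fun a => [M a]) Z.
Proof.
move=> fl; pose T b := enriched_hom V (unit_indicator V (@above_spread _ P b)) M.
have TP b := ehom_eval_universal V (@above_spread _ P b) M.
pose e b := [M b] - [T b].
have sumE Z : is_spread Z -> forall S (s : forall a, hom S (M a)),
    is_universal_section Z s -> [S] = \sum_(b in Z) e b.
  move: {2}#|Z| (erefl #|Z|) => n; elim: n Z => [|n IH] Z.
    move=> /eqP; rewrite cards_eq0 => /eqP-> _ S s sU.
    rewrite big_set0; apply: K0_class_zero.
    by apply: (universal_section_joint sU) => a; rewrite sU.1.1 ?inE // !comp0m.
  move=> cZ sZ S s sU.
  have [|b bm] := @minimal_in_ex _ P Z; first by rewrite -card_gt0 cZ.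
  have sZ' := spread_remove_minimal sZ bm.
  have cZ' : #|Z :\ b| = n by move: cZ; rewrite (cardsD1 b) bm.1 => -[].
  have sU' := ehom_eval_universal V sZ' M.
  rewrite (class_remove_minimal sZ bm (fl b) sU sU' (TP b)).
  by rewrite (IH _ cZ' sZ' _ _ sU') (big_setD1 b bm.1) addrC.
have eE b : e b = local_euler (fun a => [M a]) b.
  move: {2}#|above b|.+1 (leqnn #|above b|.+1) => n; elim: n b => // n IH b bn.
  rewrite local_eulerE /e (sumE _ (@above_spread _ P b) _ _ (TP b)).
  congr (_ - _); apply: eq_bigr => c cb; apply: IH.
  exact: leq_trans (card_above_lt cb) bn.
move=> Z sZ S s sU; rewrite (sumE Z sZ S s sU).
by apply: eq_bigr => b _; exact: eE.
Qed.

End FlabbyClass.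

(** * Cosyzygies of an injective resolution *)

Lemma exact_mono_kernel (C : abelianCat) (A B D : C) (f : hom A B) (g : hom B D) :
  is_mono f -> exact_at f g -> is_kernel f g.
Proof.
move=> mf ex; split; first exact: exact_comp0 ex.
case: ex => K [k [[Q [q [[qf qu] kq]] kg]]] X x /kg.2[u [uE _]].
have [D' [h hP]] := ab_mono (acatP C) mf; have [h' [h'q _]] := qu _ _ hP.1.
by apply: hP.2; rewrite -uE -h'q -compA [q \c _]compA kq.1 comp0m compm0.
Qed.

Section Cosyzygies.
Context {disp : Order.disp_t} (P : finPOrderType disp) (C : abelianCat).
Local Notation pmod := (pmod P C).
Local Notation modules := (pmodCat P C).

(** Kernels in [modules] are only given by their universal property, so they are
    compared with the kernel built stalk by stalk. *)
Lemma kernel_pointwise (K A B : modules) (k : hom K A) (f : hom A B) :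
  is_kernel k f ->
  forall a, is_kernel ((k : pmhom K A) a) ((f : pmhom A B) a).
Proof.
move=> kP a; have [K' [k' k'P]] := pm_kernel_ex f.
have [t [tE _]] := (pm_kernel k'P).2 _ _ kP.1.
have [s [sE _]] := kP.2 _ _ (pm_kernel k'P).1.
have st : (s : hom K' K) \c (t : hom K K') = idm K.
  by apply: (kernel_mono kP); rewrite compA sE tE compm1.
have tEa : (k' : pmhom K' A) a \c (t : pmhom K K') a = (k : pmhom K A) a.
  by rewrite -tE.
have sEa : (k : pmhom K A) a \c (s : pmhom K' K) a = (k' : pmhom K' A) a.
  by rewrite -sE.
have sta : (s : pmhom K' K) a \c (t : pmhom K K') a = idm _.
  by rewrite -[LHS]/(((s \c t) : pmhom K K) a) st.
split; first by rewrite -tEa compA (k'P a).1 comp0m.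
move=> X x /(k'P a).2[u [uE _]]; exists ((s : pmhom K' K) a \c u); split.
  by rewrite compA sEa.
move=> v vE; rewrite -[v]comp1m -sta -compA; congr (_ \c _).
by apply: (kernel_mono (k'P a)); rewrite compA tEa vE uE.
Qed.

Variables (N : modules) (R : injective_resolution N).

(** Counting kernels rather than cokernels, the zeroth cosyzygy is isomorphic to
    [N] and the sequences from [cosyzygy n] to [res_ob R n] to [cosyzygy n.+1]
    are uniform in [n]. *)
Definition cosyzygy n : modules := ker_ob (res_d R n).
Definition cosyzygy_incl n : pmhom (cosyzygy n) (res_ob R n) :=
  ker (res_d R n).
Definition cosyzygy_proj n : pmhom (res_ob R n) (cosyzygy n.+1) :=
  ker_lift (exact_comp0 (res_exact R n)).

Lemma cosyzygy_incl_kernel n a :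
  is_kernel (cosyzygy_incl n a) ((res_d R n : pmhom _ _) a).
Proof. exact: (kernel_pointwise (kerP (res_d R n))). Qed.

Lemma cosyzygy_projK n a :
  cosyzygy_incl n.+1 a \c cosyzygy_proj n a = (res_d R n : pmhom _ _) a.
Proof. by rewrite -(ker_liftK (exact_comp0 (res_exact R n))). Qed.

Lemma cosyzygy_proj_kernel n a :
  is_kernel (cosyzygy_incl n a) (cosyzygy_proj n a).
Proof.
have iP := cosyzygy_incl_kernel n a.
have mi := kernel_mono (cosyzygy_incl_kernel n.+1 a).
split; first by apply: mi; rewrite compA cosyzygy_projK iP.1 compm0.
by move=> X x px; apply: iP.2; rewrite -cosyzygy_projK -compA px compm0.
Qed.

Lemma cosyzygy_proj_epi n a : is_epi (cosyzygy_proj n a).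
Proof.
apply: (@pm_epi _ P C (res_ob R n) (cosyzygy n.+1) (cosyzygy_proj n)).
apply: (exact_lift_epi (res_exact R n) (kerP _)); exact: ker_liftK.
Qed.

Lemma cosyzygy0_class a :
  K0_class ((cosyzygy 0 : pmod) a) = K0_class ((N : pmod) a).
Proof.
have augP := exact_mono_kernel (@res_mono _ _ R) (res_exact0 R).
exact: K0_class_kernel (cosyzygy_incl_kernel 0 a) (kernel_pointwise augP a).
Qed.

Lemma cosyzygy_class n a :
  K0_class ((res_ob R n : pmod) a) =
  K0_class ((cosyzygy n : pmod) a) + K0_class ((cosyzygy n.+1 : pmod) a).
Proof.
exact: K0_class_short_exact (cosyzygy_proj_kernel n a) (@cosyzygy_proj_epi n a).
Qed.

(** Each step of the resolution gains one level of flabbiness: a section of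
    [cosyzygy n.+1] over [above b] lifts to the injective [res_ob R n], because
    [cosyzygy n] is already flabby at the elements above [b], and extends to
    [b] there.  This is where finiteness of [P] bounds the number of nonzero
    Ext objects. *)
Lemma cosyzygy_flabby_at n b :
  (#|above b| <= n)%N -> flabby_at (cosyzygy n : pmod) b.
Proof.
elim: n b => [|n IH] b bn X x xs.
  exists X, (idm X), 0; split; first exact: epi_idm.
  by move=> c bc cb; move: bn; rewrite leqn0 cards_eq0 => /eqP b0;
    rewrite b0 inE in cb.
have fl c : c \in above b -> flabby_at (cosyzygy n : pmod) c.
  by move=> cb; apply: IH; rewrite -ltnS; exact: leq_trans (card_above_lt cb) bn.
have [Y [e [y [ee ys yE]]]] := flabby_section_lift (cosyzygy_proj_kernel n)
  (@cosyzygy_proj_epi n) (@above_spread _ P b) fl xs.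
have [W [e' [w [ee' wE]]]] := injective_flabby (b := b) (@res_inj _ _ R n) ys.
exists W, (e \c e'), (cosyzygy_proj n b \c w); split; first exact: epi_comp.
move=> c bc cb; rewrite compA pm_nat -compA wE //.
by rewrite !compA yE.
Qed.

Lemma cosyzygy_flabby n b : (#|P| <= n)%N -> flabby_at (cosyzygy n : pmod) b.
Proof.
move=> Pn; apply: cosyzygy_flabby_at.
exact: leq_trans (ltnW (card_above_ltP b)) Pn.
Qed.

End Cosyzygies.

(** * Euler characteristics of Ext *)

Section Ext.
Context {disp : Order.disp_t} (P : finPOrderType disp).
Variables (C : abelianCat) (V : closedSymMonoidal C).
Variables (Z : {set P}) (spreadZ : is_spread Z).
Local Notation pmod := (pmod P C).
Local Notation modules := (pmodCat P C).
Local Notation F := (enriched_hom V (unit_indicator V spreadZ)).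
Local Notation ev := (ehom_eval V spreadZ).

(** Left exactness of the enriched hom. *)
Lemma kernel_universal_section (K A B : pmod) (k : pmhom K A) (f : pmhom A B) :
  (forall a, is_kernel (k a) (f a)) ->
  exists s : forall a, hom (ker_ob (fmap F (f : @hom modules A B))) (K a),
    is_universal_section Z s /\
    forall a, k a \c s a = ev A a \c ker (fmap F (f : @hom modules A B)).
Proof.
move=> kP; set Ff := fmap F _; have kerF := kerP Ff.
have fe a : f a \c (ev A a \c ker Ff) = 0.
  by rewrite compA -(ehom_eval_nat V spreadZ f) -compA kerF.1 compm0.
pose s a := projT1 (cid ((kP a).2 _ _ (fe a))).
have sE a : k a \c s a = ev A a \c ker Ff by rewrite /s; case: cid => u [].
have [es eu] := ehom_eval_universal V spreadZ A.
have es' := section_comp (ker Ff) es.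
have ss : is_section Z s.
  split=> [a aZ|a b ab aZ]; apply: (kernel_mono (kP _)).
    by rewrite sE compm0 es'.1.
  by rewrite compA -pm_nat -compA !sE es'.2.
exists s; split=> //; split=> // X x xs.
have [u [uE _]] := eu _ _ (section_map k xs).
have Fu : Ff \c u = 0.
  apply: (universal_section_joint (ehom_eval_universal V spreadZ B)) => a.
  by rewrite compA (ehom_eval_nat V spreadZ f) -compA uE compA (kP a).1 comp0m compm0.
have [v [vE _]] := kerF.2 _ _ Fu; exists v; split=> [a|w wE].
  by apply: (kernel_mono (kP a)); rewrite compA sE -compA vE uE.
apply: (kernel_mono kerF); rewrite vE.
apply: (universal_section_joint (ehom_eval_universal V spreadZ A)) => a.
by rewrite uE compA -sE -compA wE.
Qed.

Variables (N : modules) (R : injective_resolution N).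
Let kerF n : C := ker_ob (fmap F (res_d R n)).
Let ext n : C := res_cohomology F R n.

(** Exactness of [0 -> ker d_n -> F I^n -> ker d_{n+1} -> Ext^{n+1} -> 0]. *)
Lemma ext_class n : K0_class (ext n.+1) =
  K0_class (kerF n.+1) - (K0_class (F (res_ob R n)) - K0_class (kerF n)).
Proof.
have kP : is_kernel (ker (fmap F (res_d R n))) (ker_lift (res_dd F R n)).
  have [k0 ku] := kerP (fmap F (res_d R n)).
  have mk := kernel_mono (kerP (fmap F (res_d R n.+1))).
  split; first by apply: mk; rewrite compA ker_liftK k0 compm0.
  move=> X x lx; apply: ku.
  by rewrite -(ker_liftK (res_dd F R n)) -compA lx compm0.
by rewrite (K0_class_ker_coker kP) subKr.
Qed.

(** The Ext object is the cokernel of the map induced by [cosyzygy_proj] on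
    sections, which is epi because the kernel [cosyzygy R n] is flabby. *)
Lemma ext_vanish n : (#|P| <= n)%N -> is_zero (ext n.+1).
Proof.
move=> Pn; apply/coker_epi_zero/cover_epi.
have [s [[ss _] sE]] := kernel_universal_section (cosyzygy_incl_kernel R n.+1).
have [Y [e [y [ee ys yE]]]] := flabby_section_lift (cosyzygy_proj_kernel R n)
  (@cosyzygy_proj_epi _ P C N R n) spreadZ (fun b _ => @cosyzygy_flabby _ P C N R n b Pn) ss.
have [u [uE _]] := (ehom_eval_universal V spreadZ _).2 _ _ ys.
exists Y, e, u; split=> //.
apply: (kernel_mono (kerP (fmap F (res_d R n.+1)))); rewrite compA ker_liftK.
apply: (universal_section_joint (ehom_eval_universal V spreadZ _)) => a.
rewrite compA (ehom_eval_nat V spreadZ (res_d R n)) -compA uE.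
by rewrite -cosyzygy_projK -compA yE compA sE compA.
Qed.

Let euler n := euler_sum (fun a => K0_class ((cosyzygy R n : pmod) a)) Z.

Lemma kerF_class n : (#|P| <= n)%N -> K0_class (kerF n) = euler n.
Proof.
move=> Pn.
have [s [sU _]] := kernel_universal_section (cosyzygy_incl_kernel R n).
by apply: (class_flabby V _ spreadZ sU) => b; exact: cosyzygy_flabby.
Qed.

Lemma ehom_injective_class n :
  K0_class (F (res_ob R n)) = euler n + euler n.+1.
Proof.
rewrite -(euler_sumD _ (cosyzygy_class R n)).
apply: (class_flabby V _ spreadZ (ehom_eval_universal V spreadZ _)) => b.
exact: injective_flabby (@res_inj _ _ R n).
Qed.

(** The contributions of the cosyzygies telescope, leaving the first one and an
    error term that vanishes once the cosyzygy is flabby. *)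
Lemma ext_partial_sum n :
  \sum_(d < n.+1) K0_class (ext d) *~ (-1) ^+ d =
  euler 0 + (K0_class (kerF n) - euler n) *~ (-1) ^+ n.
Proof.
elim: n => [|n IH].
  by rewrite big_ord_recl big_ord0 addr0 expr0 !mulr1z addrC subrK.
rewrite big_ord_recr /= IH ext_class ehom_injective_class -addrA; congr (_ + _).
rewrite exprS mulN1r !mulrNz -mulrzBl -mulNrz; congr (_ *~ _).
rewrite !opprB -[K0_class (kerF n) - _]opprB [euler n + _ - _]addrAC.
by rewrite -[X in _ + X]addrA addKr.
Qed.

End Ext.

Theorem proposition4p8 (disp : Order.disp_t) (P : finPOrderType disp)
    (C : abelianCat) (V : closedSymMonoidal C) (EI : enough_injectives C)
    (Z : {set P}) (spreadZ : is_spread Z) (N : pmod P C) :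
  (exists D : nat, forall d : nat, (D <= d)%N ->
     is_zero (Ext V EI d (unit_indicator V spreadZ) N)) /\
  euler_char V EI (unit_indicator V spreadZ) N =
    \sum_(d \in [set: nat])
      (\sum_(s in order_complex P d | simplex_min s \in Z)
         K0_class (N (simplex_max s))) *~ (-1) ^+ d.
Proof.
have vanish d : (#|P|.+1 <= d)%N ->
    is_zero (Ext V EI d (unit_indicator V spreadZ) N).
  by case: d => // n; exact: ext_vanish.
split; first by exists #|P|.+1.
rewrite (euler_sum_chains (fun a => K0_class (N a))) /euler_char.
rewrite (@fsum_nat_bounded _ _ #|P|.+1) => [|d /vanish/K0_class_zero->]; last first.
  exact: mul0rz.
pose R := chosen_resolution (pmod_enough_injectives EI) (N : pmodCat P C).
rewrite (ext_partial_sum V spreadZ R) kerF_class // subrr mul0rz addr0.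
apply: eq_bigr => b _; apply: eq_bigr => d _; congr (_ *~ _).
by apply: eq_bigr => s _; exact: cosyzygy0_class.
Qed.
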